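(* For every partition $\mu$, $s_\mu=\sum_{\nu\supseteq\mu}f_{\nu/\mu}(\alpha,\beta)\,G^{(-\alpha,-\beta)}_\nu$ (in $\hat\Lambda$) and $g^{(\alpha,\beta)}_\mu=\sum_{\nu\subseteq\mu}f_{\mu/\nu}(\alpha,\beta)\,s_\nu$.
   Context: Let $\alpha,\beta$ be indeterminates, $\Lambda$ the ring of symmetric functions over $\mathbb{Z}[\alpha,\beta]$, $\hat\Lambda$ its completion, $\langle\cdot,\cdot\rangle:\Lambda\times\hat\Lambda\to\mathbb{Z}[\alpha,\beta]$ the Hall inner product with $\langle s_\lambda,s_\mu\rangle=\delta_{\lambda\mu}$. For a partition $\lambda$ and $n\ge1$, $G^{(\alpha,\beta)}_\lambda(x_1,\ldots,x_n)=\det\Big[\frac{x_i^{\lambda_j+n-j}(1+\beta x_i)^{j-1}}{(1-\alpha x_i)^{\lambda_j}}\Big]_{1\le i,j\le n}\Big/\prod_{i<j}(x_i-x_j)$, stable under $x_{n+1}=0$, defining $G^{(\alpha,\beta)}_\lambda\in\hat\Lambda$ (same definition for parameters $(-\alpha,-\beta)$). The polynomials $g^{(\alpha,\beta)}_\lambda\in\Lambda$ are defined by $\langle g^{(\alpha,\beta)}_\lambda,G^{(-\alpha,-\beta)}_\mu\rangle=\delta_{\lambda\mu}$. The coefficients $f_{\mu/\nu}(\alpha,\beta)$ for $\nu\subseteq\mu$: consider the lattice $\mathbb{Z}^2$ with allowed steps and weights: every up step $(x,y)\to(x,y+1)$ has weight $1$; a right step $(x,y)\to(x+1,y)$ with $x<0$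 has weight $\alpha$ if $y\ge0$ and $\alpha+\beta$ if $y<0$; a diagonal step $(x,y)\to(x+1,y+1)$ with $x\ge0$ has weight $\beta$ if $y\ge0$ and $\alpha+\beta$ if $y<0$; no other steps are allowed (right steps with $x\ge0$ and diagonal steps with $x<0$ have weight $0$). Let $\ell=\ell(\mu)$ and let $d$ be the number of boxes on the main diagonal of $\nu$ (i.e. the number of $i$ with $\nu_i\ge i$). Set $A_i=(i-\mu_i,1-i)$, $B_i=(i-\nu_i,\nu_i-i)$ for $1\le i\le d$, and $A_i=(i-\mu_i,1-\mu_i)$, $B_i=(i-\nu_i,i-\nu_i-1)$ for $d<i\le\ell$. Then $f_{\mu/\nu}(\alpha,\beta)=\sum_{\mathcal P}w(\mathcal P)$, summed over all families $\mathcal P=(P_1,\ldots,P_\ell)$ of pairwise vertex-disjoint lattice paths with $P_i$ from $A_i$ to $B_i$, where $w(\mathcal P)$ is the product of the weights of all steps. (For $\mu=\varnothing$, $f_{\varnothing/\varnothing}=1$.)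
   Formalization: The starting points A_i are split at the number of diagonal boxes of μ, not ν (the B_i still use ν): with ν the claim fails, as f_{(2)/∅} would be (α+β)^2 but must be 0. The formula for G_λ is imposed only for n≥ℓ(λ), where it is stable. *)

(* Defs.v *)
From HB Require Import structures.
From mathcomp Require Import all_boot all_order all_algebra fingroup perm.
From mathcomp Require Import boolp classical_sets fsbigop.
From mathcomp Require Import mpoly.

Set Implicit Arguments.
Unset Strict Implicit.
Unset Printing Implicit Defensive.

Import Order.TTheory GRing.Theory Num.Theory.
Local Open Scope ring_scope.

(** * Formal power series in n variables *)

Definition mpser (n : nat) (R : Type) : Type := 'X_{1..n} -> R.

HB.instance Definition _ n R := gen_eqMixin (mpser n R).
HB.instance Definition _ n R := gen_choiceMixin (mpser n R).

Section PowerSeries.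
Variables (n : nat) (R : comNzRingType).
Implicit Types (f g h : mpser n R) (m : 'X_{1..n}) (d : nat).

Definition mpser_zero : mpser n R := fun=> 0.
Definition mpser_opp f : mpser n R := fun m => - f m.
Definition mpser_add f g : mpser n R := fun m => f m + g m.

Fact mpser_addA : associative mpser_add.
Proof. by move=> f g h; apply/funext => m; apply: addrA. Qed.
Fact mpser_addC : commutative mpser_add.
Proof. by move=> f g; apply/funext => m; apply: addrC. Qed.
Fact mpser_add0 : left_id mpser_zero mpser_add.
Proof. by move=> f; apply/funext => m; apply: add0r. Qed.
Fact mpser_addN : left_inverse mpser_zero mpser_opp mpser_add.
Proof. by move=> f; apply/funext => m; apply: addNr. Qed.

HB.instance Definition _ := GRing.isZmodule.Build (mpser n R)
  mpser_addA mpser_addC mpser_add0 mpser_addN.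

Definition mpser_one : mpser n R := fun m => (m == 0%MM)%:R.

(* Cauchy product; both exponents have degree at most [mdeg m]. *)
Definition mpser_mul f g : mpser n R := fun m =>
  \sum_(k : 'X_{1..n < (mdeg m).+1, (mdeg m).+1} | m == (k.1 + k.2)%MM)
    f k.1 * g k.2.

Definition mpser_trunc d f : {mpoly R[n]} :=
  \sum_(k : 'X_{1..n < d}) f k *: 'X_[k].

Lemma mpser_truncE d f m : (mdeg m < d)%N -> (mpser_trunc d f)@_m = f m.
Proof. exact: mcoeff_mpoly. Qed.

Lemma mcoeffM_eq (p p' q q' : {mpoly R[n]}) m :
  (forall k, (mdeg k <= mdeg m)%N -> p@_k = p'@_k) ->
  (forall k, (mdeg k <= mdeg m)%N -> q@_k = q'@_k) ->
  (p * q)@_m = (p' * q')@_m.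
Proof.
move=> hp hq; rewrite !mcoeffM; apply: eq_bigr => -[k1 k2] _ /=.
by rewrite hp ?hq // -ltnS bmdeg.
Qed.

Lemma mpser_mulE d f g m : (mdeg m < d)%N ->
  mpser_mul f g m = (mpser_trunc d f * mpser_trunc d g)@_m.
Proof.
move=> hd; rewrite mcoeffM; apply: eq_bigr => -[k1 k2] _ /=.
by rewrite !mpser_truncE // (leq_trans (bmdeg _)).
Qed.

Lemma mpser_trunc_mul d f g m : (mdeg m < d)%N ->
  (mpser_trunc d (mpser_mul f g))@_m = (mpser_trunc d f * mpser_trunc d g)@_m.
Proof. by move=> hd; rewrite mpser_truncE // (mpser_mulE _ _ hd). Qed.

Lemma mpser_trunc_one d m : (mdeg m < d)%N ->
  (mpser_trunc d mpser_one)@_m = (1 : {mpoly R[n]})@_m.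
Proof. by move=> hd; rewrite mpser_truncE // mcoeff1. Qed.

Lemma mpser_trunc_add d f g m : (mdeg m < d)%N ->
  (mpser_trunc d (mpser_add f g))@_m = (mpser_trunc d f + mpser_trunc d g)@_m.
Proof. by move=> hd; rewrite mcoeffD !mpser_truncE. Qed.

Fact mpser_mulA : associative mpser_mul.
Proof.
move=> f g h; apply/funext => m; have hm := ltnSn (mdeg m).
rewrite !(mpser_mulE _ _ hm).
rewrite (mcoeffM_eq (p' := mpser_trunc (mdeg m).+1 f)
  (q' := mpser_trunc (mdeg m).+1 g * mpser_trunc (mdeg m).+1 h)) //; last first.
  by move=> k hk; rewrite mpser_trunc_mul.
rewrite mulrA; apply/esym/mcoeffM_eq => // k hk.
by rewrite mpser_trunc_mul.
Qed.

Fact mpser_mulC : commutative mpser_mul.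
Proof.
move=> f g; apply/funext => m; have hm := ltnSn (mdeg m).
by rewrite !(mpser_mulE _ _ hm) mulrC.
Qed.

Fact mpser_mul1 : left_id mpser_one mpser_mul.
Proof.
move=> f; apply/funext => m; have hm := ltnSn (mdeg m).
rewrite (mpser_mulE _ _ hm).
rewrite (mcoeffM_eq (p' := 1) (q' := mpser_trunc (mdeg m).+1 f)) //.
  by rewrite mul1r mpser_truncE.
by move=> k hk; rewrite mpser_trunc_one.
Qed.

Fact mpser_mulDl : left_distributive mpser_mul mpser_add.
Proof.
move=> f g h; apply/funext => m; have hm := ltnSn (mdeg m).
rewrite [RHS]/mpser_add !(mpser_mulE _ _ hm) -mcoeffD -mulrDl.
by apply: mcoeffM_eq => // k hk; rewrite mpser_trunc_add.
Qed.

Fact mpser_one_neq0 : mpser_one != 0.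
Proof.
apply/eqP => /(congr1 (fun f => f 0%MM)); rewrite /mpser_one eqxx.
by apply/eqP/oner_neq0.
Qed.

HB.instance Definition _ := GRing.Zmodule_isComNzRing.Build (mpser n R)
  mpser_mulA mpser_mulC mpser_mul1 mpser_mulDl mpser_one_neq0.

Definition mpser_scale (c : R) f : mpser n R := fun m => c * f m.

Fact mpser_scaleA c e f :
  mpser_scale c (mpser_scale e f) = mpser_scale (c * e) f.
Proof. by apply/funext => m; apply: mulrA. Qed.
Fact mpser_scale1 : left_id 1 mpser_scale.
Proof. by move=> f; apply/funext => m; apply: mul1r. Qed.
Fact mpser_scaleDr : right_distributive mpser_scale +%R.
Proof. by move=> c f g; apply/funext => m; apply: mulrDr. Qed.
Fact mpser_scaleDl f : {morph mpser_scale^~ f : c e / c + e}.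
Proof. by move=> c e; apply/funext => m; apply: mulrDl. Qed.

HB.instance Definition _ := GRing.Zmodule_isLmodule.Build R (mpser n R)
  mpser_scaleA mpser_scale1 mpser_scaleDr mpser_scaleDl.

Fact mpser_scaleAl (c : R) f g : c *: (f * g) = (c *: f) * g.
Proof.
apply/funext => m; transitivity (c * mpser_mul f g m) => //.
by rewrite /mpser_mul big_distrr; apply: eq_bigr => k _; apply: mulrA.
Qed.

HB.instance Definition _ :=
  GRing.Lmodule_isLalgebra.Build R (mpser n R) mpser_scaleAl.

Definition mpser_unit : pred (mpser n R) := fun f => `[< exists g, g * f = 1 >].
Definition mpser_inv f : mpser n R :=
  if mpser_unit f then xget 0 [set g | g * f = 1]%classic else f.

Fact mpser_mulVx : {in mpser_unit, left_inverse 1 mpser_inv *%R}.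
Proof.
move=> f uf; rewrite /mpser_inv ifT //; have /asboolP ex := uf.
exact: (@xgetPex _ 0 [set g | g * f = 1]%classic ex).
Qed.
Fact mpser_unitPl f g : g * f = 1 -> mpser_unit f.
Proof. by move=> gf1; apply/asboolP; exists g. Qed.
Fact mpser_inv_out : {in [predC mpser_unit], mpser_inv =1 id}.
Proof. by move=> f uf; rewrite /mpser_inv ifF //; apply: negbTE. Qed.

HB.instance Definition _ := GRing.ComNzRing_hasMulInverse.Build (mpser n R)
  mpser_mulVx mpser_unitPl mpser_inv_out.

Definition mpser_var (i : 'I_n) : mpser n R := fun m => (m == U_(i)%MM)%:R.

Lemma mpserME f g m : (f * g) m =
  \sum_(k : 'X_{1..n < (mdeg m).+1, (mdeg m).+1} | m == (k.1 + k.2)%MM)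
    f k.1 * g k.2.
Proof. by []. Qed.
Lemma mpserDE f g m : (f + g) m = f m + g m. Proof. by []. Qed.
Lemma mpserNE f m : (- f) m = - f m. Proof. by []. Qed.
Lemma mpserZE c f m : (c *: f) m = c * f m. Proof. by []. Qed.
Lemma mpser1E m : (1 : mpser n R) m = (m == 0%MM)%:R. Proof. by []. Qed.

Lemma mpser_mulXE f (i : 'I_n) m :
  (f * mpser_var i) m = if (0 < m i)%N then f (m - U_(i))%MM else 0.
Proof.
have hm := ltnSn (mdeg m); rewrite [LHS](mpser_mulE _ _ hm).
rewrite (mcoeffM_eq (p' := mpser_trunc (mdeg m).+1 f) (q' := 'X_i)) //;
  last by move=> k hk; rewrite mpser_truncE ?ltnS // mcoeffX eq_sym.
case: ifP => hi.
  have e : (U_(i) <= m)%MM by rewrite lep1mP lt0n_neq0.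
  have := mcoeffMX (mpser_trunc (mdeg m).+1 f) U_(i)%MM (m - U_(i))%MM.
  rewrite addmC submK // => ->; rewrite mpser_truncE //.
  exact: leq_ltn_trans (mdegB _ _) hm.
rewrite mcoeffM big1 // => -[k1 k2] /= /eqP e; rewrite mcoeffX.
case: eqP => [e2|]; rewrite ?mulr0 //.
have := congr1 (fun z : 'X_{1..n} => z i) e.
by rewrite mnmDE -e2 mnm1E eqxx addn1 => e3; rewrite e3 in hi.
Qed.

Lemma mpser_geom (c : R) (i : 'I_n) :
  ((fun m => if m == (U_(i) *+ m i)%MM then c ^+ m i else 0) : mpser n R)
    * (1 - c *: mpser_var i) = 1.
Proof.
set f := (X in X * _ = _).
rewrite mulrBr mulr1 -[_ * (_ *: _)]mulrC -scalerAl [mpser_var i * f]mulrC.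
apply/funext => m.
rewrite mpserDE mpserNE mpserZE mpser_mulXE mpser1E /f.
have [hi|hi] := posnP (m i).
  by rewrite hi mulm0n expr0 mulr0 subr0; case: eqP.
have e : (U_(i) <= m)%MM by rewrite lep1mP -lt0n.
have hmi : m i = ((m - U_(i))%MM i).+1.
  by rewrite -{1}(submK e) mnmDE mnm1E eqxx addn1.
have -> : (m == 0%MM) = false.
  by apply/negbTE/eqP => m0; rewrite m0 mnm0E in hi.
have -> : (m == (U_(i) *+ m i)%MM) =
          ((m - U_(i))%MM == (U_(i) *+ (m - U_(i))%MM i)%MM).
  by rewrite hmi mulmSr -[RHS](eqm_add2r U_(i)%MM) submK.
case: ifP => _; last by rewrite mulr0 subrr.
by rewrite hmi exprS subrr.
Qed.

Lemma mpser_geom_unit (c : R) (i : 'I_n) :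
  1 - c *: mpser_var i \is a GRing.unit.
Proof. by apply/unitrPr; eexists; rewrite mulrC; apply: mpser_geom. Qed.

End PowerSeries.

Arguments mpser_var {n R} i.

(** * Partitions *)

Definition is_intpart (s : seq nat) : bool := sorted geq s && (0%N \notin s).

Record intpart := IntPart { parts :> seq nat; _ : is_intpart parts }.

HB.instance Definition _ := [isSub for parts].
HB.instance Definition _ := [Countable of intpart by <:].

(* The parts are numbered from 0 and extended by zeros. *)
Definition part (l : intpart) (i : nat) : nat := nth 0%N l i.

Definition subpart (nu mu : intpart) : bool :=
  all (fun i => part nu i <= part mu i)%N (iota 0 (size nu)).

(* Number of boxes on the main diagonal. *)
Definition durfee (l : intpart) : nat :=
  count (fun i => i < part l i)%N (iota 0 (size l)).

(** * Symmetric functions *)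

(* The completed ring of symmetric functions is the inverse limit, along
   x_(n+1) = 0, of the symmetric power series in x_1, ..., x_n; the ring of
   symmetric functions consists of its elements of bounded degree.  Only the
   module structures are needed. *)

Definition mpfam (R : Type) : Type := forall n, mpser n R.

HB.instance Definition _ R := gen_eqMixin (mpfam R).
HB.instance Definition _ R := gen_choiceMixin (mpfam R).

Section Families.
Variable R : comNzRingType.
Implicit Types F G H : mpfam R.

Definition mpfam_zero : mpfam R := fun=> 0.
Definition mpfam_opp F : mpfam R := fun n => - F n.
Definition mpfam_add F G : mpfam R := fun n => F n + G n.
Definition mpfam_scale (c : R) F : mpfam R := fun n => c *: F n.

Fact mpfam_ext F G : (forall n, F n = G n) -> F = G.
Proof. exact: functional_extensionality_dep. Qed.

Fact mpfam_addA : associative mpfam_add.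
Proof. by move=> F G H; apply: mpfam_ext => n; apply: addrA. Qed.
Fact mpfam_addC : commutative mpfam_add.
Proof. by move=> F G; apply: mpfam_ext => n; apply: addrC. Qed.
Fact mpfam_add0 : left_id mpfam_zero mpfam_add.
Proof. by move=> F; apply: mpfam_ext => n; apply: add0r. Qed.
Fact mpfam_addN : left_inverse mpfam_zero mpfam_opp mpfam_add.
Proof. by move=> F; apply: mpfam_ext => n; apply: addNr. Qed.

HB.instance Definition _ := GRing.isZmodule.Build (mpfam R)
  mpfam_addA mpfam_addC mpfam_add0 mpfam_addN.

Fact mpfam_scaleA c e F :
  mpfam_scale c (mpfam_scale e F) = mpfam_scale (c * e) F.
Proof. by apply: mpfam_ext => n; apply: scalerA. Qed.
Fact mpfam_scale1 : left_id 1 mpfam_scale.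
Proof. by move=> F; apply: mpfam_ext => n; apply: scale1r. Qed.
Fact mpfam_scaleDr : right_distributive mpfam_scale +%R.
Proof. by move=> c F G; apply: mpfam_ext => n; apply: scalerDr. Qed.
Fact mpfam_scaleDl F : {morph mpfam_scale^~ F : c e / c + e}.
Proof. by move=> c e; apply: mpfam_ext => n; apply: scalerDl. Qed.

HB.instance Definition _ := GRing.Zmodule_isLmodule.Build R (mpfam R)
  mpfam_scaleA mpfam_scale1 mpfam_scaleDr mpfam_scaleDl.

Definition mpfam_symmetric F : Prop :=
  forall n (s : 'S_n) (m : 'X_{1..n}), F n [multinom m (s i) | i < n] = F n m.

(* [mnmwiden m] is the exponent [m] with exponent 0 for the last variable. *)
Definition mpfam_stable F : Prop :=
  forall n (m : 'X_{1..n}), F n.+1 (mnmwiden m) = F n m.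

Definition symser_pred : pred (mpfam R) :=
  fun F => `[< mpfam_symmetric F /\ mpfam_stable F >].

Record symser := SymSer { symser_val :> mpfam R; _ : symser_val \in symser_pred }.
Arguments symser_val : clear implicits.

HB.instance Definition _ := [isSub for symser_val].
HB.instance Definition _ := [Choice of symser by <:].

Fact symser_submod : submod_closed symser_pred.
Proof.
split=> [|c F G /asboolP [sF tF] /asboolP [sG tG]]; apply/asboolP; split=> //.
  move=> n s m; transitivity (c * F n [multinom m (s i) | i < n] +
    G n [multinom m (s i) | i < n]) => //.
  by rewrite sF sG.
move=> n m; transitivity (c * F n.+1 (mnmwiden m) + G n.+1 (mnmwiden m)) => //.
by rewrite tF tG.
Qed.

HB.instance Definition _ := GRing.isSubmodClosed.Build R (mpfam R) symser_pred
  symser_submod.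
HB.instance Definition _ := [SubChoice_isSubLmodule of symser by <:].

Definition symfun_pred : pred symser :=
  fun F : symser => `[< exists d, forall n (m : 'X_{1..n}),
    (d <= mdeg m)%N -> symser_val F n m = 0 >].

Record symfun := SymFun { symfun_val :> symser; _ : symfun_val \in symfun_pred }.
Arguments symfun_val : clear implicits.

HB.instance Definition _ := [isSub for symfun_val].
HB.instance Definition _ := [Choice of symfun by <:].

Fact symfun_submod : submod_closed symfun_pred.
Proof.
split=> [|c F G /asboolP [d hF] /asboolP [e hG]]; apply/asboolP.
  by exists 0%N.
exists (maxn d e) => n m; rewrite geq_max => /andP [hd he].
transitivity (c * symser_val F n m + symser_val G n m) => //.
by rewrite hF // hG // mulr0 addr0.
Qed.

HB.instance Definition _ := GRing.isSubmodClosed.Build R symser symfun_pred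
  symfun_submod.
HB.instance Definition _ := [SubChoice_isSubLmodule of symfun by <:].

(* Convergence of the series of the [u i], for [i] satisfying [P], in the
   topology of the degree filtration. *)
Definition sums_to (I : choiceType) (P : pred I) (u : I -> symser) (S : symser)
    : Prop :=
  forall d, exists s0 : seq I, forall s : seq I,
    uniq s -> {subset s0 <= s} ->
    forall n (m : 'X_{1..n}), (mdeg m < d)%N ->
      symser_val (\sum_(i <- s | P i) u i) n m = symser_val S n m.

Definition vandermonde (n : nat) : mpser n R :=
  \prod_(i < n) \prod_(j < n | (i < j)%N) (mpser_var i - mpser_var j).
Arguments vandermonde : clear implicits.

(* [F] is the Schur function of [l]: the ratio of alternants. *)
Definition is_schur (l : intpart) (F : mpfam R) : Prop :=
  forall n, (size l <= n)%N ->
    F n * vandermonde n =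
    \det (\matrix_(i < n, j < n) mpser_var i ^+ (part l j + n - j.+1)).

Definition schur (l : intpart) : symfun :=
  xget 0 [set F : symfun | is_schur l F]%classic.

(* The defining formula is stable under x_(n+1) = 0 only for n >= size l; for
   n < size l the series in n variables is 0. *)
Definition is_groth (a b : R) (l : intpart) (F : mpfam R) : Prop :=
  forall n, (size l <= n)%N ->
    F n * vandermonde n =
    \det (\matrix_(i < n, j < n)
      (mpser_var i ^+ (part l j + n - j.+1) * (1 + b *: mpser_var i) ^+ j
       / (1 - a *: mpser_var i) ^+ part l j)).

Definition groth (a b : R) (l : intpart) : symser :=
  xget 0 [set F : symser | is_groth a b l F]%classic.

Definition schur_coef (F : symser) : intpart -> R :=
  xget (fun=> 0) [set c : intpart -> R |
    sums_to xpredT (fun l => c l *: (schur l : symser)) F]%classic.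

(* The sum has finite support. *)
Definition hall (f : symfun) (F : symser) : R :=
  \sum_(l \in [set: intpart]%classic) schur_coef f l * schur_coef F l.

Definition dual_groth (a b : R) (l : intpart) : symfun :=
  xget 0 [set g : symfun |
    forall m : intpart, hall g (groth (- a) (- b) m) = (l == m)%:R]%classic.

End Families.

Arguments symser_val {R} _.
Arguments symfun_val {R} _.
Arguments vandermonde {R} n.
Arguments schur {R} l.

(** * Lattice paths *)

Definition lpoint : Type := (int * int)%type.

Section Paths.
Variable R : comNzRingType.
Variables a b : R.

Definition up_step (p q : lpoint) : bool := q == (p.1, p.2 + 1).
Definition right_step (p q : lpoint) : bool :=
  (p.1 < 0) && (q == (p.1 + 1, p.2)).
Definition diag_step (p q : lpoint) : bool :=
  (0 <= p.1) && (q == (p.1 + 1, p.2 + 1)).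

Definition lattice_step : rel lpoint :=
  fun p q => [|| up_step p q, right_step p q | diag_step p q].

Definition step_weight (p q : lpoint) : R :=
  if right_step p q then (if 0 <= p.2 then a else a + b)
  else if diag_step p q then (if 0 <= p.2 then b else a + b)
  else 1.

(* A path from [A] is given by the sequence of its vertices other than [A]. *)
Definition is_lpath (A B : lpoint) (s : seq lpoint) : bool :=
  path lattice_step A s && (last A s == B).

Definition lpath_weight (A : lpoint) (s : seq lpoint) : R :=
  \prod_(w <- pairmap step_weight A s) w.

(* Paths are numbered from 0, so that [i.+1] is the number of the row.  The case
   distinction for the sources uses the main diagonal of [mu], the one for the
   targets that of [nu].  Using the diagonal of [nu] for the sources as well
   would be wrong: the coefficient for mu = (2) and nu = 0, which has to be 0,
   would be (a + b)^2, from the path (-1,-1), (0,-1), (1,0). *)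
Definition source (mu : intpart) (i : nat) : lpoint :=
  if (i < durfee mu)%N then (i.+1%:Z - (part mu i)%:Z, 1 - i.+1%:Z)
  else (i.+1%:Z - (part mu i)%:Z, 1 - (part mu i)%:Z).

Definition target (nu : intpart) (i : nat) : lpoint :=
  if (i < durfee nu)%N then (i.+1%:Z - (part nu i)%:Z, (part nu i)%:Z - i.+1%:Z)
  else (i.+1%:Z - (part nu i)%:Z, i.+1%:Z - (part nu i)%:Z - 1).

Definition disjoint_paths (mu nu : intpart) (P : {ffun 'I_(size mu) -> seq lpoint})
    : bool :=
  [forall i : 'I_(size mu), is_lpath (source mu i) (target nu i) (P i)] &&
  [forall i : 'I_(size mu), forall j : 'I_(size mu), (i != j) ==>
    ~~ has (mem (source mu i :: P i)) (source mu j :: P j)].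

Definition fcoef (mu nu : intpart) : R :=
  \sum_(P \in [set P | disjoint_paths nu P]%classic)
    \prod_(i < size mu) lpath_weight (source mu i) (P i).

End Paths.

(** * Coefficient ring *)

Notation Zab := {mpoly int[2]}.
Definition alpha : Zab := 'X_ord0.
Definition beta : Zab := 'X_ord_max.

(* Main.v *)
(** In the variable [u = x / (1 + a x)], and up to a factor common to the whole row,
   the columns of the alternants of [s_mu] and of [G^(-a,-b)_nu] become
   [u^(mu_j - j) (1 - a u)^(j - mu_j - 1)] and [u^(nu_j - j) (1 - (a + b) u)^(j - 1)].
   The matrix of the coefficients of
   [u^(mu_i - i)] in [(1 - (a + b) u)^(1 - i) u^(nu_j - j) (1 - (a + b) u)^(j - 1)]
   is triangular with determinant 1 if [mu = nu] and has determinant 0 otherwise, so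
   by Cauchy-Binet the determinants of the coefficients of
   [u^(mu_i - i)] in [(1 - (a + b) u)^(1 - i) u^(nu_j - j) (1 - a u)^(j - nu_j - 1)]
   are inverse to the Schur coefficients of the [G^(-a,-b)].  These determinants are the
   [f_(mu/nu)]: after a shear of the half plane [x >= 0] all steps of a path are up or
   right unit steps, the sources lie in the rows [1 - i], the entry of indices [i, j]
   counts the paths from the i-th source to the j-th target, and the families of paths
   are systems of walkers on a line that never meet. *)

From HB Require Import structures.
Require Import Defs.
From mathcomp Require Import all_boot all_order all_algebra fingroup perm.
From mathcomp Require Import boolp classical_sets fsbigop.
From mathcomp Require Import mpoly zify ring.

Set Implicit Arguments.
Unset Strict Implicit.
Unset Printing Implicit Defensive.

Import Order.TTheory GRing.Theory Num.Theory.
Local Open Scope ring_scope.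

#[local] Arguments part : simpl never.

(** * Multivariate power series *)

(** Schur functions, the G and the g are defined by choice, so existence and uniqueness precede any
    computation. The tool is the coefficient of x^(l + staircase) in F times the Vandermonde
    product, which is the Schur coordinate of F. An alternant is divided by the Vandermonde product
    through a determinant of complete homogeneous series; uniqueness of the quotient is a leading
    monomial argument in each degree.

    Cauchy-Binet is applied to partitions in a box, where the sums are finite and exact. It gives
    the product of the two transition matrices in one order, which is the duality of g and G; the
    expansion of s needs the other order, which holds because the matrices of a box are square.

    The paths start and stop at different times, while a step by step expansion of the determinant
    needs walkers with a common clock. The weights are therefore cut to 0 before a source may be
    left and beyond the targets, which forces waiting. The cut depends on time and place but not on
    the walker, so all rows share the same weights. *)

Section Convolution.
Variable R : comNzRingType.

Lemma mpser_sumE n (I : Type) (r : seq I) (P : pred I) (F : I -> mpser n R) m :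
  (\sum_(i <- r | P i) F i) m = \sum_(i <- r | P i) F i m.
Proof. exact: (big_morph (fun f : mpser n R => f m)). Qed.

Lemma mpserM_divisors n (f g : mpser n R) m (r : seq 'X_{1..n}) :
  uniq r -> (forall k, (k \in r) = (k <= m)%MM) ->
  (f * g) m = \sum_(k <- r) f k * g (m - k)%MM.
Proof.
move=> ur hr; rewrite mpserME.
pose B := 'X_{1..n < (mdeg m).+1}.
rewrite -(pair_big_dep xpredT (fun k1 k2 : B => m == (k1 + k2)%MM)
  (fun k1 k2 : B => f k1 * g k2)) /=.
have hlt (k : 'X_{1..n}) : (k <= m)%MM -> (mdeg k < (mdeg m).+1)%N.
  by move=> /submK <-; rewrite ltnS mdegD leq_addl.
have hB (k1 : B) : \sum_(k2 : B | m == (k1 + k2)%MM) f k1 * g k2 =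
    if (val k1 <= m)%MM then f k1 * g (m - k1)%MM else 0.
  case: ifP => h; last first.
    rewrite big1 // => k2 /eqP he; suff: (val k1 <= m)%MM by rewrite h.
    apply/mnm_lepP => i; have := congr1 (fun z : 'X_{1..n} => z i) he.
    by rewrite mnmDE => ->; apply: leq_addr.
  have h2 : (mdeg (m - k1)%MM < (mdeg m).+1)%N by rewrite ltnS mdegB.
  rewrite (big_pred1 (BMultinom h2)) // => k2 /=.
  apply/eqP/eqP => [e|->] /=; last by rewrite addmC submK.
  apply/val_inj/mnmP => i /=; rewrite mnmBE.
  by have := congr1 (fun z : 'X_{1..n} => z i) e; rewrite mnmDE => ->; rewrite addKn.
rewrite (eq_bigr _ (fun k _ => hB k)) -big_mkcond /=.
rewrite -(big_map val (fun k => (k <= m)%MM) (fun k => f k * g (m - k)%MM)).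
rewrite -big_filter; apply: perm_big; apply: uniq_perm => //.
  by rewrite filter_uniq // map_inj_uniq ?index_enum_uniq //; apply: val_inj.
move=> k; rewrite mem_filter hr; case: (boolP (k <= m)%MM) => //= h.
by apply/mapP; exists (BMultinom (hlt _ h)); rewrite ?mem_index_enum.
Qed.

Definition mdivisors n (m : 'X_{1..n}) : seq 'X_{1..n} :=
  [seq bmnm k | k <- enum {: 'X_{1..n < (mdeg m).+1}} & (bmnm k <= m)%MM].

Lemma mdivisors_uniq n (m : 'X_{1..n}) : uniq (mdivisors m).
Proof.
by rewrite map_inj_uniq; [apply/filter_uniq/enum_uniq|apply: val_inj].
Qed.

Lemma mem_mdivisors n (m k : 'X_{1..n}) : (k \in mdivisors m) = (k <= m)%MM.
Proof.
apply/mapP/idP => [[k'] |h]; first by rewrite mem_filter => /andP [? _] ->.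
have hk : (mdeg k < (mdeg m).+1)%N by rewrite -(submK h) ltnS mdegD leq_addl.
by exists (BMultinom hk) => //; rewrite mem_filter /= h mem_enum.
Qed.

(** Common core of the multiplicativity of three maps: setting a variable to 0, permuting the
    variables, substituting one variable. The hypotheses make [th] a bijection from the divisors of
    [m] to those of [th m] that respects complements. *)
Lemma mpserM_pullback n p (th : 'X_{1..n} -> 'X_{1..p}) (f g : mpser p R) m :
  injective th ->
  (forall k, (k <= th m)%MM -> exists2 k', (k' <= m)%MM & k = th k') ->
  (forall k, (k <= m)%MM -> (th k <= th m)%MM) ->
  (forall k, (k <= m)%MM -> th (m - k)%MM = (th m - th k)%MM) ->
  (f * g) (th m) = ((f \o th : mpser n R) * (g \o th : mpser n R)) m.
Proof.
move=> inj h1 h2 h3.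
rewrite (@mpserM_divisors _ _ _ _ (map th (mdivisors m))); first last.
- move=> k; apply/mapP/idP => [[k']|/h1 [k' hk' ->]].
    by rewrite mem_mdivisors => /h2 h ->.
  by exists k'; rewrite ?mem_mdivisors.
- by rewrite map_inj_uniq ?mdivisors_uniq.
rewrite (mpserM_divisors _ _ (mdivisors_uniq m) (mem_mdivisors m)) big_map.
rewrite big_seq [RHS]big_seq; apply: eq_bigr => k.
by rewrite mem_mdivisors => /h3 e /=; rewrite e.
Qed.

End Convolution.

(** * Setting the last variable to 0 *)

Section Restriction.
Variables (R : comNzRingType) (n : nat).

Definition mpser_restr (f : mpser n.+1 R) : mpser n R := fun m => f (mnmwiden m).

Lemma mnmwidenB (m k : 'X_{1..n}) : mnmwiden (m - k) = (mnmwiden m - mnmwiden k)%MM.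
Proof.
apply/mnmP => i; rewrite mnmBE; case: (unliftP ord_max i) => [j|] ->.
  rewrite (_ : lift ord_max j = widen_ord (leqnSn n) j); last exact/val_inj/lift_max.
  by rewrite !mnmwiden_widen mnmBE.
by rewrite !mnmwiden_ordmax.
Qed.

Definition mnmnarrow (m : 'X_{1..n.+1}) : 'X_{1..n} :=
  [multinom m (widen_ord (leqnSn n) i) | i < n].

Lemma mnmnarrowK (m : 'X_{1..n.+1}) : m ord_max = 0%N -> mnmwiden (mnmnarrow m) = m.
Proof.
move=> h; apply/mnmP => i; case: (unliftP ord_max i) => [j|] ->; last first.
  by rewrite mnmwiden_ordmax h.
rewrite (_ : lift ord_max j = widen_ord (leqnSn n) j); last exact/val_inj/lift_max.
by rewrite mnmwiden_widen mnmE.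
Qed.

Lemma mdeg_mnmwiden (m : 'X_{1..n}) : mdeg (mnmwiden m) = mdeg m.
Proof.
rewrite !mdegE big_ord_recr /= mnmwiden_ordmax addn0.
by apply: eq_bigr => i _; rewrite mnmwiden_widen.
Qed.

Fact mpser_restr_zmod : zmod_morphism mpser_restr.
Proof. by []. Qed.

HB.instance Definition _ :=
  GRing.isZmodMorphism.Build (mpser n.+1 R) (mpser n R) mpser_restr mpser_restr_zmod.

Fact mpser_restr_monoid : monoid_morphism mpser_restr.
Proof.
split=> [|f g]; apply/funext => m; rewrite /mpser_restr.
  by rewrite !mpser1E -mnmwiden0 (inj_eq (@inj_mnmwiden n)).
apply: mpserM_pullback => [|k hk|k|k _]; first exact: inj_mnmwiden; last first.
- exact: mnmwidenB.
- move/mnm_lepP => h; apply/mnm_lepP => i.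
  case: (unliftP ord_max i) => [j|] ->; last by rewrite !mnmwiden_ordmax.
  rewrite (_ : lift ord_max j = widen_ord (leqnSn n) j); last exact/val_inj/lift_max.
  by rewrite !mnmwiden_widen.
have k0 : k ord_max = 0%N.
  by have := mnm_lepP hk ord_max; rewrite mnmwiden_ordmax leqn0 => /eqP.
exists (mnmnarrow k); last by rewrite mnmnarrowK.
apply/mnm_lepP => i; rewrite mnmE; have := mnm_lepP hk (widen_ord (leqnSn n) i).
by rewrite mnmwiden_widen.
Qed.

HB.instance Definition _ :=
  GRing.isMonoidMorphism.Build (mpser n.+1 R) (mpser n R) mpser_restr
    mpser_restr_monoid.

End Restriction.

(** * Power series in one variable *)

Section Univariate.
Variable R : comNzRingType.
Local Notation ser := (mpser 1 R).
Local Notation X := (mpser_var (@ord0 0) : ser).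

Definition cf (f : ser) (k : nat) : R := f (U_(ord0) *+ k)%MM.

Lemma mnm1_ord0 (m : 'X_{1..1}) : m = (U_(ord0) *+ m ord0)%MM.
Proof. by apply/mnmP => i; rewrite mulmnE mnm1E ord1 eqxx mul1n. Qed.

Lemma cfP (f g : ser) : (forall k, cf f k = cf g k) -> f = g.
Proof. by move=> h; apply/funext => m; rewrite (mnm1_ord0 m); apply: h. Qed.

Lemma cfD f g k : cf (f + g) k = cf f k + cf g k. Proof. by []. Qed.
Lemma cfB f g k : cf (f - g) k = cf f k - cf g k. Proof. by []. Qed.
Lemma cfZ c f k : cf (c *: f) k = c * cf f k. Proof. by []. Qed.

Lemma cf1 k : cf 1 k = (k == 0%N)%:R.
Proof. by rewrite /cf mpser1E -mdeg_eq0 mdegMn mdeg1 mul1n. Qed.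

Lemma cfMX f k : cf (f * X) k = if k is k'.+1 then cf f k' else 0.
Proof.
rewrite /cf mpser_mulXE mulmnE mnm1E eqxx mul1n.
by case: k => [|k] //=; rewrite mulmSr addmK.
Qed.

Lemma cfMXn f d k : cf (f * X ^+ d) k = if (d <= k)%N then cf f (k - d) else 0.
Proof.
elim: d f k => [|d ih] f k; first by rewrite mulr1 subn0.
by rewrite exprSr mulrA cfMX; case: k => [|k]; rewrite ?ih // subSS.
Qed.

Lemma cfM (f g : ser) k : cf (f * g) k = \sum_(i < k.+1) cf f i * cf g (k - i).
Proof.
rewrite /cf (@mpserM_divisors _ _ _ _ _ [seq (U_(ord0) *+ i)%MM | i <- iota 0 k.+1]).
- rewrite big_map -(big_mkord xpredT (fun i => cf f i * cf g (k - i))) /index_iota.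
  rewrite subn0 /cf !big_seq; apply: eq_bigr => i; rewrite mem_iota /= add0n ltnS => hi.
  congr (_ * g _); apply/mnmP => j; rewrite mnmBE !mulmnE; exact/esym/mulnBr.
- rewrite map_inj_uniq ?iota_uniq // => i j /mnmP /(_ ord0).
  by rewrite !mulmnE mnm1E eqxx !mul1n.
- move=> m; rewrite [m]mnm1_ord0; apply/mapP/mnm_lepP => [[i]|/(_ ord0)].
    rewrite mem_iota /= add0n ltnS => hi -> j.
    by rewrite !mulmnE leq_mul2l hi orbT.
  rewrite !mulmnE mnm1E eqxx !mul1n => h; exists (m ord0) => //.
  by rewrite mem_iota /= add0n ltnS.
Qed.

End Univariate.

(** * Evaluation of a univariate series at one of the variables *)

Section Substitution.
Variables (R : comNzRingType) (n : nat) (i : 'I_n).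
Local Notation ser := (mpser 1 R).

Definition subst_var (f : ser) : mpser n R :=
  fun m => if m == (U_(i) *+ m i)%MM then cf f (m i) else 0.

Fact subst_var_zmod : zmod_morphism subst_var.
Proof.
move=> f g; apply/funext => m; rewrite mpserDE mpserNE /subst_var.
by case: eqP => // _; rewrite subr0.
Qed.

HB.instance Definition _ :=
  GRing.isZmodMorphism.Build ser (mpser n R) subst_var subst_var_zmod.

Fact subst_var_monoid : monoid_morphism subst_var.
Proof.
split=> [|f g]; apply/funext => m.
  rewrite mpser1E /subst_var cf1 -mdeg_eq0.
  case: eqP => [e|ne].
    by rewrite [X in mdeg X]e mdegMn mdeg1 mul1n.
  by case: eqP => //= /eqP; rewrite mdeg_eq0 => /eqP e; case: ne; rewrite e mnm0E.

(* If [m] is not a power of x_i, both sides are 0: two powers of x_i with product [m] would make [m]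
   such a power. *)
have [e|ne] := eqVneq m (U_(i) *+ m i)%MM; last first.
  rewrite (mpserM_divisors _ _ (mdivisors_uniq m) (mem_mdivisors m)).
  rewrite {1}/subst_var (negbTE ne) big_seq big1 // => k.
  rewrite mem_mdivisors /subst_var => hk.
  case: eqP => [e1|_]; last by rewrite mul0r.
  case: eqP => [e2|_]; last by rewrite mulr0.
  case/eqP: ne; apply/mnmP => j; have E1 : k j = ((i == j) * k i)%N.
    by rewrite {1}e1 mulmnE mnm1E.
  have E2 : (m j - k j = (i == j) * (m i - k i))%N.
    by rewrite -mnmBE {1}e2 mulmnE mnm1E mnmBE.
  have hi := mnm_lepP hk i; have hj := mnm_lepP hk j.
  by rewrite mulmnE mnm1E -(subnK hj) -(subnK hi) E2 [in LHS]E1 -mulnDr.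
pose th (k : 'X_{1..1}) := (U_(i) *+ k ord0)%MM : 'X_{1..n}.
have thK (h : ser) : (subst_var h \o th : ser) = h.
  apply/funext => k; rewrite /= /subst_var /th mulmnE mnm1E eqxx mul1n eqxx.
  by rewrite /cf -mnm1_ord0.
have hth : m = th (U_(ord0) *+ m i)%MM by rewrite /th mulmnE mnm1E eqxx mul1n.
rewrite {1}/subst_var -e eqxx [in RHS]hth mpserM_pullback ?thK //.
- move=> k k' /mnmP /(_ i); rewrite /th !mulmnE mnm1E eqxx !mul1n => hk.
  by rewrite (mnm1_ord0 k) (mnm1_ord0 k') hk.
- rewrite -hth => k /mnm_lepP hk; exists (U_(ord0) *+ k i)%MM.
    by apply/mnm_lepP => j; rewrite !mulmnE leq_mul.
  rewrite /th mulmnE mnm1E eqxx mul1n; apply/mnmP => j; rewrite mulmnE mnm1E.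
  case: eqP => [<-|/eqP ij]; first by rewrite mul1n.
  have := hk j; rewrite e mulmnE mnm1E (negbTE ij) !mul0n.
  by rewrite leqn0 => /eqP.
- move=> k /mnm_lepP hk; apply/mnm_lepP => j; rewrite /th !(mulmnE U_(i)).
  by rewrite leq_mul.
- by move=> k _; apply/mnmP => j; rewrite /th mnmBE !mulmnE mnmBE mulnBr !mulmnE.
Qed.

HB.instance Definition _ :=
  GRing.isMonoidMorphism.Build ser (mpser n R) subst_var subst_var_monoid.

Lemma subst_varZ c f : subst_var (c *: f) = c *: subst_var f.
Proof.
by apply/funext => m; rewrite mpserZE /subst_var; case: eqP; rewrite ?mulr0.
Qed.

Lemma subst_var_X : subst_var (mpser_var ord0) = mpser_var i.
Proof.
apply/funext => m; rewrite /subst_var /cf /mpser_var.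
have [->|ne] := eqVneq m U_(i)%MM; first by rewrite mnm1E eqxx mulm1n !eqxx.
case: eqP => // e; case: eqP => // /mnmP /(_ ord0).
rewrite mulmnE !mnm1E eqxx mul1n => h.
by rewrite e h mulm1n eqxx in ne.
Qed.

(** Since [h] does not involve x_i, the first factor has to supply the whole power of x_i in [m]. *)
Lemma subst_varM_coef (f : ser) (h : mpser n R) (m : 'X_{1..n}) :
  (forall k : 'X_{1..n}, k i != 0%N -> h k = 0) ->
  (subst_var f * h) m = cf f (m i) * h (m - U_(i) *+ m i)%MM.
Proof.
move=> hh; rewrite (mpserM_divisors _ _ (mdivisors_uniq m) (mem_mdivisors m)).
have hd : (U_(i) *+ m i <= m)%MM.
  apply/mnm_lepP => j; rewrite mulmnE mnm1E.
  by case: eqP => [->|_]; rewrite ?mul1n.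
rewrite (bigD1_seq (U_(i) *+ m i)%MM) ?mdivisors_uniq ?mem_mdivisors //=.
rewrite /subst_var mulmnE mnm1E eqxx mul1n eqxx big_seq_cond big1 ?addr0 // => k.
rewrite mem_mdivisors => /andP [/mnm_lepP hk ne]; case: eqP => [e|]; rewrite ?mul0r //.
rewrite hh ?mulr0 // mnmBE subn_eq0 -ltnNge ltn_neqAle hk andbT.
by apply: contra ne => /eqP <-; apply/eqP.
Qed.

End Substitution.

Lemma subst_var_prod_coef (R : comNzRingType) n (f : 'I_n -> mpser 1 R)
    (s : seq 'I_n) (m : 'X_{1..n}) : uniq s ->
  (\prod_(i <- s) subst_var i (f i)) m =
    if [forall i, (i \in s) || (m i == 0%N)] then \prod_(i <- s) cf (f i) (m i) else 0.
Proof.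
elim: s m => [|i s ih] m /=.
  rewrite !big_nil mpser1E => _; case: forallP => [h|h].
    by rewrite (_ : m = 0%MM) ?eqxx //; apply/mnmP => i; rewrite mnm0E; apply/eqP/h.
  case: eqP => // e; case: h => i; by rewrite e mnm0E eqxx.
move=> /andP [his us]; rewrite !big_cons subst_varM_coef => [|k hk]; last first.
  rewrite ih //; case: forallP => // /(_ i); by rewrite (negbTE his) (negbTE hk).
rewrite ih //.
have e1 : [forall j, (j \in s) || ((m - U_(i) *+ m i)%MM j == 0%N)] =
  [forall j, (j \in i :: s) || (m j == 0%N)].
  apply: eq_forallb => j; rewrite in_cons mnmBE mulmnE mnm1E [j == i]eq_sym.
  by have [->|_] := eqVneq i j; rewrite /= ?mul1n ?subnn ?eqxx ?orbT // mul0n subn0.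
rewrite e1; case: ifP => // _; last by rewrite mulr0.
congr (_ * _); rewrite !big_seq; apply: eq_bigr => j hj.
rewrite mnmBE mulmnE mnm1E; case: eqP => [e|_]; last by rewrite mul0n subn0.
by rewrite e hj in his.
Qed.

(** Taking a coefficient is not multiplicative, but each Leibniz term is a product of series in
    distinct variables, whose coefficients do factor. *)
Lemma det_subst_var_coef (R : comNzRingType) n (f : 'I_n -> mpser 1 R) (m : 'X_{1..n}) :
  (\det (\matrix_(i, j) subst_var i (f j))) m = \det (\matrix_(i, j) cf (f j) (m i)).
Proof.
rewrite /determinant mpser_sumE; apply: eq_bigr => s _.
have h : (\prod_i (\matrix_(i, j) subst_var i (f j)) i (s i)) m =
    \prod_i (\matrix_(i, j) cf (f j) (m i)) i (s i).
  under eq_bigr do rewrite mxE.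
  rewrite (subst_var_prod_coef (fun i => f (s i))) ?index_enum_uniq //.
  rewrite ifT; last by apply/forallP => i; rewrite mem_index_enum.
  by apply: eq_bigr => i _; rewrite mxE.
by case: (s : bool); rewrite ?expr1 ?expr0 ?mulN1r ?mul1r ?mpserNE h.
Qed.

(** * Permutation of the variables *)

Section Permutation.
Variables (R : comNzRingType) (n : nat) (s : 'S_n).

Definition mnm_perm (m : 'X_{1..n}) : 'X_{1..n} := [multinom m (s i) | i < n].

Definition mpser_perm (f : mpser n R) : mpser n R := fun m => f (mnm_perm m).

Lemma mdeg_mnm_perm m : mdeg (mnm_perm m) = mdeg m.
Proof.
rewrite !mdegE [RHS](reindex_inj (@perm_inj _ s)) /=.
by apply: eq_bigr => i _; rewrite mnmE.
Qed.

Fact mpser_perm_zmod : zmod_morphism mpser_perm.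
Proof. by []. Qed.

HB.instance Definition _ :=
  GRing.isZmodMorphism.Build (mpser n R) (mpser n R) mpser_perm mpser_perm_zmod.

Lemma mnm_permP (k m : 'X_{1..n}) : (mnm_perm k <= mnm_perm m)%MM = (k <= m)%MM.
Proof.
apply/mnm_lepP/mnm_lepP => h i; last by rewrite !mnmE.
by have := h (s^-1 i)%g; rewrite !mnmE permKV.
Qed.

Lemma mnm_perm_inj : injective mnm_perm.
Proof.
move=> k m /mnmP h; apply/mnmP => i.
by have := h (s^-1 i)%g; rewrite !mnmE permKV.
Qed.

Fact mpser_perm_monoid : monoid_morphism mpser_perm.
Proof.
split=> [|f g]; apply/funext => m; rewrite /mpser_perm.
  by rewrite !mpser1E -!mdeg_eq0 mdeg_mnm_perm.
apply: mpserM_pullback => [|k hk|k|k _]; first exact: mnm_perm_inj.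
- have e : k = mnm_perm [multinom k ((s^-1)%g i) | i < n].
    by apply/mnmP => i; rewrite !mnmE permK.
  by exists [multinom k ((s^-1)%g i) | i < n]; rewrite // -mnm_permP -e.
- by rewrite mnm_permP.
- by apply/mnmP => i; rewrite !mnmE.
Qed.

HB.instance Definition _ :=
  GRing.isMonoidMorphism.Build (mpser n R) (mpser n R) mpser_perm mpser_perm_monoid.

End Permutation.

(** * Leading monomials and cancellation of the Vandermonde product *)

Section LeadingTerm.
Variables (R : idomainType) (n : nat).
Implicit Types (p q : {mpoly R[n]}) (f : mpser n R).

Definition mpser_poly p : mpser n R := fun m => p@_m.

Fact mpser_poly_zmod : zmod_morphism mpser_poly.
Proof. by move=> p q; apply/funext => m; rewrite /mpser_poly mcoeffB. Qed.

HB.instance Definition _ := GRing.isZmodMorphism.Build {mpoly R[n]} (mpser n R)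
  mpser_poly mpser_poly_zmod.

Fact mpser_poly_monoid : monoid_morphism mpser_poly.
Proof.
split=> [|p q]; apply/funext => m; rewrite /mpser_poly; first by rewrite mcoeff1.
by rewrite mcoeffM mpserME.
Qed.

HB.instance Definition _ := GRing.isMonoidMorphism.Build {mpoly R[n]} (mpser n R)
  mpser_poly mpser_poly_monoid.

Lemma mpser_polyX i : mpser_poly 'X_i = mpser_var i.
Proof. by apply/funext => m; rewrite /mpser_poly mcoeffX eq_sym. Qed.

(** A series may have no leading monomial, but each nonzero homogeneous component is a polynomial
    and has one. *)
Definition hompart (k : nat) f : {mpoly R[n]} :=
  \sum_(m : 'X_{1..n < k.+1} | mdeg m == k) f m *: 'X_[m].

Lemma hompartE k f (m : 'X_{1..n}) : (hompart k f)@_m = if mdeg m == k then f m else 0.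
Proof.
rewrite /hompart raddf_sum /=; under eq_bigr do rewrite mcoeffZ mcoeffX.
case: eqP => [e|ne]; last first.
  rewrite big1 // => m' /eqP e; case: eqP => [e2|]; last by rewrite mulr0.
  by case: ne; rewrite -e2.
have hm : (mdeg m < k.+1)%N by rewrite e.
rewrite (bigD1 (BMultinom hm)) /= ?e ?eqxx ?mulr1 // big1 ?addr0 // => m' /andP [_ ne].
case: eqP => [e2|]; last by rewrite mulr0.
by case/eqP: ne; apply/val_inj.
Qed.

Lemma mpserM_hompart f q D k (m : 'X_{1..n}) : q \is D.-homog -> mdeg m = (k + D)%N ->
  (f * mpser_poly q) m = (hompart k f * q)@_m.
Proof.
move=> hq hm; rewrite mpserME mcoeffM; apply: eq_bigr => -[k1 k2] /= /eqP e.
rewrite hompartE /mpser_poly; have [->|nz] := eqVneq q@_k2 0; first by rewrite !mulr0.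
have h2 : mdeg k2 = D by apply: (dhomog_mf hq); rewrite mcoeff_msupp.
have h := congr1 mdeg e; rewrite mdegD h2 in h.
by rewrite ifT // -(eqn_add2r D) -h; apply/eqP.
Qed.

Definition vdm_poly : {mpoly R[n]} :=
  \prod_(i < n) \prod_(j < n | (i < j)%N) ('X_i - 'X_j).

Lemma vandermonde_poly : vandermonde n = mpser_poly vdm_poly.
Proof.
rewrite rmorph_prod; apply: eq_bigr => i _; rewrite rmorph_prod.
by apply: eq_bigr => j _; rewrite rmorphB /= !mpser_polyX.
Qed.

Definition staircase : 'X_{1..n} := [multinom n - i.+1 | i < n].

Lemma mlead_XB (i j : 'I_n) : (i < j)%N ->
  mlead ('X_i - 'X_j : {mpoly R[n]}) = U_(i)%MM.
Proof.
move=> hij; rewrite mleadDl ?mleadXm // mleadN !mleadXm.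
apply/ltmcP; first by rewrite !mdeg1.
exists i => [k hk|]; rewrite !mnm1E ?eqxx.
  by rewrite -!val_eqE /= !gtn_eqF // (ltn_trans hk).
by rewrite -val_eqE /= gtn_eqF.
Qed.

Lemma XB_neq0 (i j : 'I_n) : (i < j)%N -> 'X_i - 'X_j != 0 :> {mpoly R[n]}.
Proof.
move=> hij; apply: contraTneq isT => e; have := mlead_XB hij.
by rewrite e mlead0 => /mnmP /(_ i); rewrite mnm0E mnm1E eqxx.
Qed.

Lemma mleadc_XB (i j : 'I_n) : (i < j)%N ->
  mleadc ('X_i - 'X_j : {mpoly R[n]}) = 1.
Proof.
move=> hij; rewrite mlead_XB // mcoeffB !mcoeffX eqxx eq_mnm1.
by rewrite -val_eqE /= gtn_eqF // subr0.
Qed.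

Lemma vdm_poly_neq0 : vdm_poly != 0.
Proof. by apply/prodf_neq0 => i _; apply/prodf_neq0 => j; apply: XB_neq0. Qed.

Lemma mlead_vdm_poly : mlead vdm_poly = staircase.
Proof.
rewrite mlead_prod => [|i _ _]; last by apply/prodf_neq0 => j; apply: XB_neq0.
apply/mnmP => i; rewrite mnm_sumE mnmE.
have e (k : 'I_n) : mlead (\prod_(j < n | (k < j)%N) ('X_k - 'X_j : {mpoly R[n]})) =
    (U_(k) *+ (n - k.+1))%MM.
  rewrite mlead_prod => [|j _]; last exact: XB_neq0.
  rewrite (eq_bigr (fun=> U_(k)%MM)) => [|j]; last exact: mlead_XB.
  apply/mnmP => j; rewrite mnm_sumE mulmnE.
  rewrite (eq_bigr (fun=> U_(k)%MM j * 1)%N) => [|? _]; last by rewrite muln1.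
  rewrite -big_distrr /=; congr (_ * _)%N.
  rewrite -(big_mkord (fun j => k < j)%N (fun=> 1%N)).
  by rewrite -(@big_nat_widenl _ _ _ _ 0 n predT) // sum_nat_const_nat muln1.
rewrite (bigD1 i) //= e mulmnE mnm1E eqxx mul1n big1 ?addn0 // => k ne.
by rewrite e mulmnE mnm1E (negbTE ne).
Qed.

Lemma mleadc_vdm_poly : vdm_poly@_staircase = 1.
Proof.
rewrite -mlead_vdm_poly /vdm_poly mlead_prod => [|i _ _]; last first.
  by apply/prodf_neq0 => j; apply: XB_neq0.
rewrite mleadc_prod big1 // => i _; rewrite mlead_prod => [|j _]; last exact: XB_neq0.
by rewrite mleadc_prod big1 // => j; apply: mleadc_XB.
Qed.

Lemma vdm_poly_homog : vdm_poly \is (mdeg staircase).-homog.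
Proof.
have [D hD] : exists D, vdm_poly \is D.-homog; last first.
  suff <- : D = mdeg staircase by [].
  rewrite -mlead_vdm_poly; rewrite (dhomog_mf hD) //.
  exact/mlead_supp/vdm_poly_neq0.
have hprod (I : Type) (r : seq I) (P : pred I) (F : I -> {mpoly R[n]}) :
    (forall i, P i -> exists D, F i \is D.-homog) ->
    exists D, \prod_(i <- r | P i) F i \is D.-homog.
  move=> hF; apply: (big_ind (fun p : {mpoly R[n]} => exists D, p \is D.-homog))
    => [|p q [d hd] [e he]|]; last exact: hF.
    by exists 0%N; apply: dhomog1.
  by exists (d + e)%N; apply: dhomogM.
apply: (hprod) => i _; apply: (hprod) => j _; exists 1%N.
by apply: rpredB; rewrite dhomogX /= mdeg1.
Qed.

(** The monomial is the leading one of the component of degree [k]. Leading monomials add up under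
    products, and that of the Vandermonde product is the staircase with coefficient 1. For symmetric
    [f] the exponents of a leading monomial decrease, so it is a partition. *)
Lemma mulr_vandermonde_lead f k m0 : mdeg m0 = k -> f m0 != 0 ->
  exists m, [/\ mdeg m = k, f m != 0, (f * vandermonde n) (m + staircase)%MM = f m &
    (forall (s : 'S_n) m', f (mnm_perm s m') = f m') ->
      forall i j : 'I_n, (i <= j)%N -> (m j <= m i)%N].
Proof.
move=> hm0 nz; set p := hompart k f.
have nzp : p != 0.
  apply: contra nz => /eqP p0; have := hompartE k f m0.
  by rewrite -/p p0 mcoeff0 hm0 eqxx => <-.
have := mlead_supp nzp; rewrite mcoeff_msupp hompartE.
case: ifP => [/eqP hm|_]; last by rewrite eqxx.
move=> nzm; exists (mlead p); split=> //.
  rewrite vandermonde_poly (mpserM_hompart _ (k := k) vdm_poly_homog) ?mdegD ?hm //.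
  by rewrite -mlead_vdm_poly mleadcM mlead_vdm_poly mleadc_vdm_poly mulr1 hompartE hm eqxx.
move=> sym; apply: mlead_msym_sorted; apply/issymP => s; apply/mpolyP => m.
rewrite mcoeff_sym !hompartE mdeg_mperm; case: ifP => // _; exact: (sym s m).
Qed.

Lemma mulr_vandermonde_eq0 f k :
  (forall m, mdeg m = (k + mdeg staircase)%N -> (f * vandermonde n) m = 0) ->
  forall m, mdeg m = k -> f m = 0.
Proof.
move=> h m hm; apply/eqP/contraT => nz.
have [m' [hm' nz' e _]] := mulr_vandermonde_lead hm nz.
by rewrite -e h ?eqxx ?mdegD ?hm' in nz'.
Qed.

Lemma mulr_vandermonde_inj f g : f * vandermonde n = g * vandermonde n -> f = g.
Proof.
move=> e; apply/eqP; rewrite -subr_eq0; apply/eqP/funext => m.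
apply: (@mulr_vandermonde_eq0 (f - g) (mdeg m)) => // m' _.
by rewrite mulrBl e subrr.
Qed.

End LeadingTerm.

(** * Alternants and the Vandermonde determinant *)

Section JacobiTrudi.
Variable R : comNzRingType.
Local Notation ser := (mpser 1 R).
Local Notation X := (mpser_var (@ord0 0) : ser).

(* The sum of [cf f k *: h_(k - q)], with [h] the complete homogeneous symmetric
   series. *)
Definition hseries n (q : nat) (f : ser) : mpser n R := fun m => cf f (mdeg m + q).
Arguments hseries : clear implicits.

Definition ser_shift (f : ser) : ser := fun m => f (m + U_(ord0))%MM.

Lemma cf_shift f k : cf (ser_shift f) k = cf f k.+1.
Proof. by rewrite /cf /ser_shift mulmSr. Qed.

Lemma hseries_shift n q f : hseries n q.+1 f = hseries n q (ser_shift f).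
Proof. by apply/funext => m; rewrite /hseries cf_shift addnS. Qed.

(* The [eps q] are the signed elementary symmetric polynomials in the variables
   of [s]; multiplying the generating series of the [h] by the product of the
   [1 - x_i t], for [i] in [s], sets these variables to 0. *)
Lemma hseries_elim n (s : seq 'I_n) : uniq s ->
  exists eps : nat -> mpser n R, forall f,
    \sum_(q < (size s).+1) eps q * hseries n q f =
    (fun m => if all (fun i => m i == 0%N) s then cf f (mdeg m) else 0).
Proof.
elim: s => [_|i s ih /andP [his /ih {ih} [eps heps]]].
  exists (fun=> 1) => f; rewrite big_ord1 mul1r /=; apply/funext => m.
  by rewrite /hseries addn0.
pose eps' q : mpser n R := (if (q <= size s)%N then eps q else 0) -
  (if q is q'.+1 then eps q' * mpser_var i else 0).
exists eps' => f /=.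
have -> : \sum_(q < (size s).+2) eps' q * hseries n q f =
    \sum_(q < (size s).+1) eps q * hseries n q f -
    (\sum_(q < (size s).+1) eps q * hseries n q (ser_shift f)) * mpser_var i.
  under eq_bigr do rewrite mulrBl; rewrite sumrB; congr (_ - _).
    rewrite big_ord_recr /= ltnn mul0r addr0; apply: eq_bigr => q _.
    by rewrite -ltnS ltn_ord.
  rewrite big_ord_recl /= mul0r add0r mulr_suml; apply: eq_bigr => q _.
  by rewrite /= hseries_shift mulrAC.
rewrite !heps; apply/funext => m; rewrite mpserDE mpserNE mpser_mulXE /=.
have [m0|mp] /= := posnP (m i); first by rewrite subr0.
have hU : (U_(i) <= m)%MM by rewrite lep1mP -lt0n.
have -> : all (fun j => (m - U_(i))%MM j == 0%N) s = all (fun j => m j == 0%N) s.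
  apply: eq_in_all => j hj; rewrite mnmBE mnm1E; have [e|_] := eqVneq i j;
    last by rewrite subn0.
  by rewrite e hj in his.
case: ifP => _; last by rewrite subrr.
rewrite cf_shift; have -> : (mdeg (m - U_(i))%MM).+1 = mdeg m.
  by rewrite -[in RHS](submK hU) mdegD mdeg1 addn1.
by rewrite subrr.
Qed.

Lemma subst_var_all n (k : 'I_n) (f : ser) : subst_var k f =
  (fun m => if all (fun i => m i == 0%N) [seq i <- enum 'I_n | i != k]
            then cf f (mdeg m) else 0).
Proof.
apply/funext => m; rewrite /subst_var; case: allP => [h|h].
  have e : m = (U_(k) *+ m k)%MM.
    apply/mnmP => i; rewrite mulmnE mnm1E; have [->|ne] := eqVneq k i.
      by rewrite mul1n.
    by apply/eqP/h; rewrite mem_filter mem_enum eq_sym ne.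
  by rewrite -e eqxx [in RHS]e mdegMn mdeg1 mul1n.
case: eqP => // e; case: h => i; rewrite mem_filter e mulmnE mnm1E eq_sym.
by case: eqP.
Qed.

(** Setting to 0 all variables except x_k turns complete homogeneous polynomials into powers of x_k.
    The coefficients of this elimination depend on [k] only, so one matrix [E] serves all columns
    [phi]. *)
Lemma hseries_matrix n : exists E : 'M[mpser n R]_n, forall phi : 'I_n -> ser,
  \matrix_(k, j) subst_var k (phi j) =
  E *m \matrix_(p, j) hseries n (n - p.+1) (phi j).
Proof.
have /choice [eps heps] (k : 'I_n) : exists eps : nat -> mpser n R, forall f,
    \sum_(q < n) eps q * hseries n q f = subst_var k f.
  have us : uniq [seq i <- enum 'I_n | i != k] by rewrite filter_uniq ?enum_uniq.
  have [eps heps] := hseries_elim us; exists eps => f; rewrite subst_var_all -heps.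
  have -> // : (size [seq i <- enum 'I_n | i != k]).+1 = n.
  rewrite size_filter -[RHS](size_enum_ord n) -(count_predC (pred1 k) (enum 'I_n)).
  by rewrite count_uniq_mem ?enum_uniq // mem_enum.
exists (\matrix_(k, p) eps k (n - p.+1)%N) => phi; apply/matrixP => k j.
rewrite !mxE -heps (reindex_inj rev_ord_inj) /=; apply: eq_bigr => p _.
by rewrite !mxE.
Qed.

Lemma det_vandermonde n :
  \det (\matrix_(k < n, j < n) (mpser_var k : mpser n R) ^+ (n - j.+1)) = vandermonde n.
Proof.
rewrite -det_tr; pose a : 'rV[mpser n R]_n := \row_j mpser_var (rev_ord j).
have -> : (\matrix_(k < n, j < n) (mpser_var k : mpser n R) ^+ (n - j.+1))^T =
    row_perm (perm rev_ord_inj) (col_perm (perm rev_ord_inj) (Vandermonde n a)).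
  by apply/matrixP => i j; rewrite !mxE !permE rev_ordK.
rewrite row_permE col_permE !det_mulmx !det_perm mulrCA -signr_addb.
rewrite odd_permV addbb mulr1 det_Vandermonde /vandermonde.
rewrite !pair_big_dep /=.
rewrite (reindex_inj (inv_inj (f := fun p : 'I_n * 'I_n =>
  (rev_ord p.2, rev_ord p.1)) _)).
  apply: eq_big => [[i j]|[i j] _] /=; last by rewrite !mxE !rev_ordK.
  by have := ltn_ord i; have := ltn_ord j; lia.
by move=> [i j] /=; rewrite !rev_ordK.
Qed.

(** The determinant of [E] is read off from the columns [X ^+ (n - j.+1)]: there the left side is
    the Vandermonde determinant and the matrix of the [hseries] is lower unitriangular. *)
Lemma det_subst_var n (phi : 'I_n -> ser) :
  \det (\matrix_(k, j) subst_var k (phi j)) =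
  vandermonde n * \det (\matrix_(p, j) hseries n (n - p.+1) (phi j)).
Proof.
have [E hE] := hseries_matrix n; rewrite hE det_mulmx; congr (_ * _).
rewrite -det_vandermonde.
have := congr1 determinant (hE (fun j => X ^+ (n - j.+1))).
rewrite det_mulmx [X in _ = _ * X](_ : _ = 1) ?mulr1 => [<-|].
  by congr (\det _); apply/matrixP => k j; rewrite !mxE rmorphXn /= subst_var_X.
have hs (p j : 'I_n) (m : 'X_{1..n}) :
    hseries n (n - p.+1) (X ^+ (n - j.+1)) m = ((mdeg m + j)%N == p)%:R.
  rewrite /hseries -[X ^+ _]mul1r cfMXn cf1.
  have hp := ltn_ord p; have hj := ltn_ord j.
  case: ifP => h; last by case: eqP => // e; lia.
  by congr (_%:R); apply/eqP/eqP; lia.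
rewrite det_trig => [|].
  apply: big1 => i _; rewrite mxE; apply/funext => m.
  by rewrite hs mpser1E -{2}[val i]add0n eqn_add2r mdeg_eq0.
apply/is_trig_mxP => i j hij; rewrite mxE; apply/funext => m; rewrite hs.
by case: eqP => // e; move: hij; rewrite -e ltnNge leq_addl.
Qed.

End JacobiTrudi.

Arguments hseries {R} n q f.

(** Compare [nu 0] with [ka 0]: if [nu 0] is smaller the first column is 0, if it is larger the
    first row is 0, and if they agree the first column is 1 followed by zeros and induction applies.
    It yields the Kronecker deltas for Schur functions and for the pairing of [jt_det] with the
    G. *)
Lemma det_unitriangular_pair (R : comNzRingType) n (nu ka : nat -> nat) (M : 'M[R]_n) :
  (forall i, nu i.+1 <= nu i)%N -> (forall i, ka i.+1 <= ka i)%N ->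
  (forall i j : 'I_n, (i <= j)%N -> (ka j < nu i)%N -> M i j = 0) ->
  (forall i j : 'I_n, (j < i)%N -> (nu i <= ka j)%N -> M i j = 0) ->
  (forall i : 'I_n, (nu i < ka i)%N -> M i i = 0) ->
  (forall i : 'I_n, nu i = ka i -> M i i = 1) ->
  \det M = [forall i : 'I_n, nu i == ka i]%:R.
Proof.
elim: n nu ka M => [|n ih] nu ka M hnu hka h1 h2 h3 h4.
  by rewrite det_mx00 (_ : [forall i, _] = true) //; apply/forallP; case.
have mono f : (forall i, f i.+1 <= f i)%N -> forall i, (f i <= f 0)%N.
  by move=> hf; elim=> // i; apply: leq_trans.
case: (ltngtP (nu 0%N) (ka 0%N)) => h0.
- rewrite (expand_det_col _ ord0) big1 => [|i _].
    case: forallP => // /(_ ord0) /eqP e; by rewrite e ltnn in h0.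
  case: (posnP i) => [i0|ip];
    last by rewrite h2 ?mul0r // ltnW // (leq_ltn_trans (mono _ hnu i)).
  by rewrite (_ : i = ord0) ?h3 ?mul0r //; apply: val_inj.
- rewrite (expand_det_row _ ord0) big1 => [|j _].
    case: forallP => // /(_ ord0) /eqP e; by rewrite e ltnn in h0.
  by rewrite h1 ?mul0r // (leq_ltn_trans (mono _ hka j)).
rewrite (expand_det_col _ ord0) big_ord_recl h4 // mul1r big1 ?addr0 => [|i _];
  last first.
  by rewrite h2 ?mul0r // -h0 mono.
rewrite /cofactor addn0 expr0 mul1r (ih (fun i => nu i.+1) (fun i => ka i.+1)) //.
- congr ((nat_of_bool _)%:R); apply/forallP/forallP => h i.
    by case: (unliftP ord0 i) => [j|] ->; rewrite ?h0 // lift0 h.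
  by have := h (lift ord0 i); rewrite lift0.
- by move=> i j hij hh; rewrite !mxE h1 ?lift0.
- by move=> i j hij hh; rewrite !mxE h2 ?lift0.
- by move=> i hh; rewrite !mxE h3 ?lift0.
- by move=> i hh; rewrite !mxE h4 ?lift0.
Qed.

(** * Partitions *)

Section Partitions.
Implicit Types l k : intpart.

Lemma intpart_sorted l : sorted geq l.
Proof. by case: l => s /= /andP []. Qed.

Lemma part_leS l i : (part l i.+1 <= part l i)%N.
Proof.
rewrite /part; have [h|h] := ltnP i.+1 (size l); last by rewrite nth_default.
by have /(sortedP 0%N) := intpart_sorted l; apply.
Qed.

Lemma part_le l i j : (i <= j)%N -> (part l j <= part l i)%N.
Proof.
move=> /subnK <-; elim: (j - i)%N => // d ih.
exact: leq_trans (part_leS _ _) ih.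
Qed.

Lemma intpart_gt0 l i : (0 < part l i)%N = (i < size l)%N.
Proof.
rewrite /part; have [h|h] := ltnP i (size l); last by rewrite nth_default.
case: l h => s /= /andP [_ h0] h; rewrite lt0n; apply: contra h0 => /eqP <-.
exact: mem_nth.
Qed.

Lemma part_default l i : (size l <= i)%N -> part l i = 0%N.
Proof. exact: nth_default. Qed.

Lemma part_inj l k : (forall i, part l i = part k i) -> l = k.
Proof.
move=> h; apply: val_inj; apply: (@eq_from_nth _ 0%N) => [|i _]; last exact: h.
have hs k1 k2 : (forall i, part k1 i = part k2 i) -> (size k1 <= size k2)%N.
  by move=> e; rewrite leqNgt -intpart_gt0 e intpart_gt0 ltnn.
by apply/eqP; rewrite eqn_leq !hs.
Qed.

Lemma part_eqP n l k : (size l <= n)%N -> (size k <= n)%N ->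
  [forall i : 'I_n, part l i == part k i] = (l == k).
Proof.
move=> hl hk; apply/forallP/eqP => [h|-> //]; apply: part_inj => i.
have [hi|hi] := ltnP i n; first exact/eqP/(h (Ordinal hi)).
by rewrite !part_default // (leq_trans _ hi).
Qed.

Lemma subpartP nu mu : reflect (forall i, part nu i <= part mu i)%N (subpart nu mu).
Proof.
apply: (iffP allP) => [h i|h i _]; last exact: h.
have [hi|hi] := ltnP i (size nu); last by rewrite part_default.
by apply: h; rewrite mem_iota.
Qed.

Lemma subpart_size nu mu : subpart nu mu -> (size nu <= size mu)%N.
Proof.
move=> /subpartP h; rewrite leqNgt -intpart_gt0 -leqNgt.
by rewrite -[X in (_ <= X)%N](part_default (leqnn (size mu))) h.
Qed.

Lemma sumn_part n l : (size l <= n)%N -> sumn l = (\sum_(i < n) part l i)%N.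
Proof.
move=> h; rewrite sumnE (big_nth 0%N) -(big_mkord xpredT (part l)).
rewrite [RHS](@big_cat_nat _ _ _ (size l)) //= [X in (_ + X)%N]big1_seq ?addn0 // => i.
by rewrite mem_index_iota => /andP [_ /andP [hi _]]; apply: part_default.
Qed.

Lemma subpart_sumn nu mu : subpart nu mu -> (sumn nu <= sumn mu)%N.
Proof.
move=> h; rewrite !(@sumn_part (size mu)) ?(subpart_size h) //.
by apply: leq_sum => i _; move/subpartP: h; apply.
Qed.

Lemma size_le_sumn l : (size l <= sumn l)%N.
Proof.
rewrite (@sumn_part (size l)) // -[X in (X <= _)%N]card_ord -sum1_card.
by apply: leq_sum => i _; rewrite intpart_gt0.
Qed.

Lemma part_le_sumn l i : (part l i <= sumn l)%N.
Proof.
have [hi|hi] := ltnP i (size l); last by rewrite part_default.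
by rewrite (@sumn_part (size l)) // (bigD1 (Ordinal hi)) //= leq_addr.
Qed.

Lemma intpart_of_mnm n (m : 'X_{1..n}) :
  (forall i j : 'I_n, (i <= j)%N -> (m j <= m i)%N) ->
  exists l : intpart, [/\ (size l <= n)%N, forall i :
    'I_n, part l i = m i & sumn l = mdeg m].
Proof.
move=> hm; pose s := [seq x <- m | x != 0%N].
have hs : sorted geq m.
  apply/(sortedP 0%N) => i; rewrite size_tuple => hi.
  have := hm (Ordinal (ltnW hi)) (Ordinal hi) (leqnSn i).
  by rewrite !(mnm_nth 0%N).
have hp : is_intpart s.
  rewrite /is_intpart mem_filter eqxx /= sorted_filter // => x y z h1 h2.
  exact: leq_trans h2 h1.
have key i : nth 0%N s i = nth 0%N m i.
  rewrite /s; elim: (tval m) hs i => //= x t ih hx i.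
  case: eqP => [x0|_] /=; last by case: i => // i; rewrite /= ih // (path_sorted hx).
  have ht : all (fun y => y == 0%N) t.
    have := order_path_min (fun x y z h1 h2 => leq_trans h2 h1) hx.
    by apply: sub_all => y; rewrite /= x0 leqn0.
  rewrite (_ : filter _ _ = [::]) ?nth_nil; last first.
    apply/eqP; rewrite -(negbK (_ == _)) -has_filter; apply/hasPn => y hy.
    by rewrite negbK (allP ht).
  rewrite x0; case: i => //= i; have [hi|hi] := ltnP i (size t).
    by rewrite (eqP (allP ht _ (mem_nth _ hi))).
  by rewrite nth_default.
exists (IntPart hp); have hsz : (size (IntPart hp) <= n)%N.
  by rewrite -[n](size_tuple m) size_filter count_size.
split=> // [i|]; first by rewrite /part /= key -mnm_nth.
rewrite (sumn_part hsz) mdegE; apply: eq_bigr => i _.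
by rewrite /part /= key -mnm_nth.
Qed.

(** The bounds, fewer than [d] parts each below [d], are coarse: partitions of size [d] or more may
    occur in the list. *)
Definition intparts_lt (d : nat) : seq intpart :=
  pmap insub (flatten [seq [seq [seq val x | x <- tval t] | t <- enum {:
    c.-tuple 'I_d}] | c <- iota 0 d]).

Lemma mem_intparts_lt d l : (sumn l < d)%N -> l \in intparts_lt d.
Proof.
case: d => // d hl; rewrite mem_pmap_sub; apply/flattenP.
have hk : size l \in iota 0 d.+1 by rewrite mem_iota add0n (leq_ltn_trans (size_le_sumn l)).
eexists; first by apply/mapP; exists (size l).
apply/mapP; exists [tuple of [seq inord x | x <- in_tuple l]]; first by rewrite mem_enum.
rewrite /= -map_comp -[LHS]map_id; apply/eq_in_map => x hx /=.
rewrite inordK // (leq_ltn_trans _ hl) //.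
by have := part_le_sumn l (index x l); rewrite /part nth_index.
Qed.

End Partitions.

(** * Existence and uniqueness of Schur and Grothendieck functions *)

Section Alternants.
Variables (R : idomainType) (a b : R).
Local Notation ser := (mpser 1 R).
Local Notation X := (mpser_var (@ord0 0) : ser).
Implicit Types l k : intpart.

(** One column of the alternant as a univariate series; its value at x_i is the entry of row [i]. *)
Definition gser l n j : ser :=
  X ^+ (part l j + n - j.+1) * (1 + b *: X) ^+ j / (1 - a *: X) ^+ part l j.

Definition alternant l n : mpser n R :=
  \det (\matrix_(i < n, j < n) subst_var i (gser l n j)).
Arguments alternant : clear implicits.

Lemma is_grothE l (F : mpfam R) : is_groth a b l F <->
  forall n, (size l <= n)%N -> F n * vandermonde n = alternant l n.
Proof.
suff h n : \det (\matrix_(i < n, j < n)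
    (mpser_var i ^+ (part l j + n - j.+1) * (1 + b *: mpser_var i) ^+ j
      / (1 - a *: mpser_var i) ^+ part l j)) = alternant l n.
  by split=> hF n /hF ->; rewrite h.
congr (\det _); apply/matrixP => i j; rewrite !mxE /gser.
rewrite rmorphM rmorphV ?unitrX ?mpser_geom_unit // rmorphM !rmorphXn /=.
by rewrite rmorphB rmorphD !rmorph1 /= !subst_varZ subst_var_X.
Qed.

Lemma alternant_coef l n (m : 'X_{1..n}) : alternant l n m =
  \det (\matrix_(i < n, j < n) cf (gser l n j) (m i)).
Proof. exact: det_subst_var_coef. Qed.

Lemma gserS l n j : (j < n)%N -> gser l n.+1 j = X * gser l n j.
Proof.
move=> hj; rewrite /gser (_ : (part l j + n.+1 - j.+1)%N = (part l j + n - j.+1).+1);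
  last lia.
by rewrite exprS !mulrA.
Qed.

Lemma cf0M (f g : ser) : cf (f * g) 0 = cf f 0 * cf g 0.
Proof. by rewrite cfM big_ord1. Qed.

Lemma cf0X (f : ser) d : cf (f ^+ d) 0 = cf f 0 ^+ d.
Proof. by elim: d => [|d ih]; rewrite ?expr0 ?cf1 // !exprS cf0M ih. Qed.

Lemma cfX d : cf X d = (d == 1%N)%:R.
Proof. by rewrite -[X]mul1r cfMX; case: d => [|d] //; rewrite cf1. Qed.

Lemma restr_subst_var n (i : 'I_n) (f : ser) :
  mpser_restr (subst_var (widen_ord (leqnSn n) i) f) = subst_var i f.
Proof.
apply/funext => m; rewrite /mpser_restr /subst_var mnmwiden_widen -mnmwiden1.
have -> : (mnmwiden U_(i) *+ m i)%MM = mnmwiden (U_(i) *+ m i)%MM :> 'X_{1..n.+1}.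
  elim: (m i) => [|d ih]; first by rewrite !mulm0n mnmwiden0.
  by rewrite !mulmS ih mnmwidenD.
by rewrite (inj_eq (@inj_mnmwiden n)).
Qed.

Lemma restr_subst_var_max n (f : ser) :
  mpser_restr (subst_var (@ord_max n) f) = (fun m => if m == 0%MM then cf f 0 else 0).
Proof.
apply/funext => m; rewrite /mpser_restr /subst_var mnmwiden_ordmax mulm0n.
by rewrite -[X in _ == X]mnmwiden0 (inj_eq (@inj_mnmwiden n)).
Qed.

(** With the last variable set to 0, the last row keeps only constant terms. Every column but the
    last carries a positive power of X, and the last one carries the power [part l n]. The remaining
    minor has one extra factor x_i in each row. *)
Lemma restr_alternant l n : mpser_restr (alternant l n.+1) =
  if (size l <= n)%N then alternant l n * \prod_(i < n) mpser_var i else 0.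
Proof.
have hlast (j : 'I_n.+1) : mpser_restr (subst_var (@ord_max n) (gser l n.+1 j)) =
    if (j == ord_max) && (size l <= n)%N then 1 else 0.
  rewrite restr_subst_var_max; apply/funext => m; rewrite /gser -mulrA cf0M cf0X cfX /=.
  have [->|ne] /= := eqVneq j ord_max; last first.
    rewrite (_ : (part l j + n.+1 - j.+1)%N = (part l j + n - j.+1).+1).
      by rewrite expr0n /= mul0r if_same.
    by move: ne (ltn_ord j); rewrite -val_eqE /=; lia.
  rewrite addnK; case: leqP => h.
    rewrite part_default // expr0 mul1r divr1 cf0X cfD cf1 cfZ cfX mulr0 addr0 expr1n.
    by rewrite mpser1E; case: eqP.
  have hp : (part l n == 0)%N = false by apply: negbTE; rewrite -lt0n intpart_gt0.
  by rewrite expr0n hp mul0r if_same.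
rewrite -det_map_mx (expand_det_row _ ord_max) (bigD1 ord_max) //= big1 => [|j ne];
  last first.
  by rewrite !mxE hlast (negbTE ne) mul0r.
rewrite addr0 !mxE hlast eqxx /=; case: leqP => h; last by rewrite mul0r.
rewrite mul1r /cofactor -signr_odd oddD addbb expr0 mul1r mulrC.
pose d : 'rV[mpser n R]_n := \row_i mpser_var i.
have -> : \prod_(i < n) (mpser_var i : mpser n R) = \det (diag_mx d).
  by rewrite det_diag; apply: eq_bigr => i _; rewrite mxE.
rewrite -det_mulmx mul_diag_mx; congr (\det _); apply/matrixP => i j; rewrite !mxE.
have hl (u : 'I_n) : lift ord_max u = widen_ord (leqnSn n) u by exact/val_inj/lift_max.
by rewrite !hl restr_subst_var gserS //= rmorphM /= subst_var_X.
Qed.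

End Alternants.

Arguments alternant {R} a b l n.

Lemma restr_vandermonde (R : idomainType) n :
  mpser_restr (vandermonde n.+1) = vandermonde n * \prod_(i < n) mpser_var i :> mpser n R.
Proof.
(* The Vandermonde product is the alternant of the empty partition at parameters 0, so the
   restriction of alternants applies to it. *)
have h k : vandermonde k = alternant 0 0 (IntPart (isT : is_intpart [::])) k :> mpser k R.
  rewrite -det_vandermonde; congr (\det _); apply/matrixP => i j; rewrite !mxE.
  rewrite /gser /part nth_nil add0n scale0r addr0 expr1n mulr1 expr0 divr1.
  by rewrite rmorphXn /= subst_var_X.
by rewrite !h restr_alternant.
Qed.

Lemma mpser_mul_vars (R : comNzRingType) n (f : mpser n R) (m : 'X_{1..n}) :
  (f * \prod_(i < n) mpser_var i) [multinom (m i).+1 | i < n] = f m.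
Proof.
have -> : [multinom (m i).+1 | i < n] = (m + \sum_(i < n) U_(i))%MM.
  apply/mnmP => i; rewrite mnmE mnmDE mnm_sumE (bigD1 i) //= mnm1E eqxx big1 ?addn1 // => j ne.
  by rewrite mnm1E (negbTE ne).
elim: (index_enum _) f m => [|i r ih] f m; first by rewrite !big_nil mulr1 addm0.
rewrite !big_cons mulrA addmA; have := ih (f * mpser_var i) (m + U_(i))%MM => ->.
by rewrite mpser_mulXE mnmDE mnm1E eqxx addn1 addmK.
Qed.

Lemma mpser_mul_vars_inj (R : comNzRingType) n (f g : mpser n R) :
  f * \prod_(i < n) mpser_var i = g * \prod_(i < n) mpser_var i -> f = g.
Proof. by move=> e; apply/funext => m; rewrite -mpser_mul_vars e mpser_mul_vars. Qed.

(** * Schur coordinates of stable symmetric families *)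

Section StableFamilies.
Variable R : idomainType.
Implicit Types (F G : mpfam R) (S : symser R) (l k : intpart).

Lemma symser_sym S n (s : 'S_n) m : symser_val S n (mnm_perm s m) = symser_val S n m.
Proof. by case: S => F /= /asboolP [h _]; apply: h. Qed.

Lemma symser_stable S : mpfam_stable (symser_val S).
Proof. by case: S => F /= /asboolP []. Qed.

Lemma mpfam_stable_ext F G N d : mpfam_stable F -> mpfam_stable G ->
  (forall n (m : 'X_{1..n}), (N <= n)%N -> (mdeg m < d)%N -> F n m = G n m) ->
  forall n (m : 'X_{1..n}), (mdeg m < d)%N -> F n m = G n m.
Proof.
move=> sF sG; elim: N => [|N ih] h n m hm; first exact: h.
apply: ih hm => {}n {}m; rewrite leq_eqVlt => /predU1P [e|]; last exact: h.
by move=> hm; rewrite -sF -sG h ?mdeg_mnmwiden // ltnS e.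
Qed.

Definition exponent n l : 'X_{1..n} := [multinom part l i + n - i.+1 | i < n].

(** The coefficient of the Schur function of [l]: the product with the Vandermonde product turns
    Schur functions into alternants, and the only monomial with strictly decreasing exponents in the
    alternant of [l] is [exponent n l]. *)
Definition schur_coord n l F : R := (F n * vandermonde n) (exponent n l).

(** Setting the last variable to 0 multiplies the Vandermonde product in [n] variables by all the
    variables, and this is also the change from [exponent n l] to [exponent n.+1 l]. *)
Lemma schur_coordS n l S : (size l <= n)%N -> schur_coord n.+1 l S = schur_coord n l S.
Proof.
move=> h; rewrite /schur_coord.
have -> : exponent n.+1 l = mnmwiden [multinom (exponent n l i).+1 | i < n].
  apply/mnmP => i; case: (unliftP ord_max i) => [j|] ->; last first.
    by rewrite mnmwiden_ordmax mnmE part_default //= add0n subnn.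
  rewrite (_ : lift ord_max j = widen_ord (leqnSn n) j); last exact/val_inj/lift_max.
  by rewrite mnmwiden_widen !mnmE addnS subSn // (leq_trans (ltn_ord j)) // leq_addl.
rewrite -[LHS]/(mpser_restr (symser_val S n.+1 * vandermonde n.+1) _).
rewrite rmorphM /= restr_vandermonde mulrA mpser_mul_vars.
by rewrite (_ : mpser_restr _ = symser_val S n) //; apply/funext => m; apply:
  symser_stable.
Qed.

Lemma schur_coord_stable n N l S : (size l <= n)%N -> (n <= N)%N ->
  schur_coord N l S = schur_coord n l S.
Proof.
move=> h /subnK <-; elim: (N - n)%N => //= d <-; rewrite addSn.
by apply: schur_coordS; apply: leq_trans h (leq_addl _ _).
Qed.

(** A nonzero component would have a leading monomial given by a partition [l], and the
    corresponding coordinate would be its nonzero coefficient. *)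
Lemma symser_eq0_deg n d S :
  (forall l, (size l <= n)%N -> (sumn l < d)%N -> schur_coord n l S = 0) ->
  forall m : 'X_{1..n}, (mdeg m < d)%N -> symser_val S n m = 0.
Proof.
move=> h m hm; apply/eqP/contraT => nz.
have [m' [e nz' e' /(_ (@symser_sym S n)) dec]] := mulr_vandermonde_lead (erefl (mdeg m)) nz.
have [l [hl hl' hl'']] := intpart_of_mnm dec.
move: nz'; rewrite -e'.
have -> : (m' + staircase n)%MM = exponent n l.
  by apply/mnmP => i; rewrite mnmDE !mnmE hl' addnBA.
by rewrite [X in X != 0]h ?eqxx // hl'' e.
Qed.

End StableFamilies.

Section Groth.
Variables (R : idomainType) (a b : R).
Implicit Types (l k : intpart).

(** The alternant divided by the Vandermonde product, in the form of Jacobi-Trudi. The value 0 for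
    few variables is forced by stability. *)
Definition groth_fam l : mpfam R := fun n =>
  if (size l <= n)%N
  then \det (\matrix_(p < n, j < n) hseries n (n - p.+1) (gser a b l n j)) else 0.
Arguments groth_fam : clear implicits.

Lemma groth_fam_is_groth l : is_groth a b l (groth_fam l).
Proof.
apply/is_grothE => n h; rewrite /groth_fam h mulrC.
by rewrite -(det_subst_var (fun j : 'I_n => gser a b l n j)).
Qed.

Lemma groth_fam_stable l : mpfam_stable (groth_fam l).
Proof.
move=> n m; rewrite -[LHS]/(mpser_restr (groth_fam l n.+1) m).
suff -> : mpser_restr (groth_fam l n.+1) = groth_fam l n by [].
have /is_grothE hG := @groth_fam_is_groth l.
apply: mulr_vandermonde_inj; apply: mpser_mul_vars_inj.
rewrite -mulrA -restr_vandermonde -rmorphM /=.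
have [h|h] := leqP (size l) n.
  by rewrite !hG 1?leqW // restr_alternant h.
rewrite [in RHS]/groth_fam leqNgt h !mul0r.
(* At [n.+1 = size l] the restricted alternant is 0; for still fewer variables both members of the
   family are 0 by definition. *)
move: h; rewrite leq_eqVlt => /predU1P [e|h].
  by rewrite hG -?e // restr_alternant -e ltnn.
by rewrite /groth_fam leqNgt h mul0r raddf0.
Qed.

Lemma groth_fam_sym l : mpfam_symmetric (groth_fam l).
Proof.
move=> n s m; rewrite -[LHS]/(mpser_perm s (groth_fam l n) m).
suff -> : mpser_perm s (groth_fam l n) = groth_fam l n by [].
rewrite /groth_fam; case: ifP => _; last by rewrite raddf0.
rewrite -det_map_mx; congr (\det _); apply/matrixP => p j; rewrite !mxE.
by apply/funext => m'; rewrite /= /mpser_perm /hseries mdeg_mnm_perm.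
Qed.

Lemma groth_fam_symser l : groth_fam l \in symser_pred (R := R).
Proof. by apply/asboolP; split; [apply: groth_fam_sym|apply: groth_fam_stable]. Qed.

Lemma is_groth_unique l F : mpfam_stable F -> is_groth a b l F -> F = groth_fam l.
Proof.
move=> sF /is_grothE hF; apply: mpfam_ext => n; apply/funext => m.
have /is_grothE hG := @groth_fam_is_groth l.
apply: (mpfam_stable_ext (N := size l) sF (@groth_fam_stable l) _ (ltnSn _)).
move=> {}n {}m h _; congr (_ m); apply: mulr_vandermonde_inj.
by rewrite hF // hG.
Qed.

Lemma grothE l : symser_val (groth a b l) = groth_fam l.
Proof.
apply: is_groth_unique; first exact: symser_stable.
rewrite /groth; apply: (@xgetPex _ 0 [set F : symser R | is_groth a b l F]%classic).
by exists (SymSer (groth_fam_symser l)); apply: groth_fam_is_groth.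
Qed.

Lemma schur_coord_groth n l k : (size l <= n)%N ->
  schur_coord n k (groth a b l) = \det (\matrix_(i < n, j < n)
    cf (gser a b l n j) (part k i + n - i.+1)).
Proof.
move=> h; rewrite /schur_coord grothE.
have /is_grothE -> // := @groth_fam_is_groth l.
rewrite alternant_coef; congr (\det _); apply/matrixP => i j.
by rewrite !mxE mnmE.
Qed.

End Groth.

Arguments groth_fam {R} a b l _ _.

(** * Schur expansions *)

Section Schur.
Variable R : idomainType.
Implicit Types (S : symser R) (l k : intpart).

Definition scoord l S : R := schur_coord (size l) l (symser_val S).

Lemma scoordE n l S : (size l <= n)%N -> scoord l S = schur_coord n l (symser_val S).
Proof. by move=> h; rewrite (schur_coord_stable S (leqnn _) h). Qed.

Fact scoord_linear l : scalar (scoord l).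
Proof.
move=> c F G; rewrite /scoord /schur_coord.
rewrite -[X in X * _]/(c *: symser_val F (size l) + symser_val G (size l)).
by rewrite mulrDl -scalerAl.
Qed.

HB.instance Definition _ l :=
  GRing.isLinear.Build R (symser R) R *%R (scoord l) (scoord_linear l).

Lemma symser_eq0 d S : (forall l, (sumn l < d)%N -> scoord l S = 0) ->
  forall n (m : 'X_{1..n}), (mdeg m < d)%N -> symser_val S n m = 0.
Proof.
move=> h n m hm; apply: (symser_eq0_deg (d := d)) hm => l hl hs.
by rewrite -scoordE // h.
Qed.

Lemma symserP S1 S2 : (forall l, scoord l S1 = scoord l S2) -> S1 = S2.
Proof.
move=> h; apply/eqP; rewrite -subr_eq0; apply/eqP/val_inj.
apply: mpfam_ext => n; apply/funext => m.
by apply: (@symser_eq0 (mdeg m).+1) => // l _; rewrite raddfB /= h subrr.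
Qed.

(** The coordinates at partitions of size less than [d] control all coefficients of degree less than
    [d], so convergence can be tested on coordinates. *)
Lemma sums_toP (P : pred intpart) (u : intpart -> symser R) S :
  (forall l s, uniq s -> (forall k, (sumn k <= sumn l)%N -> k \in s) ->
    \sum_(k <- s | P k) scoord l (u k) = scoord l S) ->
  sums_to P u S.
Proof.
move=> h d; exists (intparts_lt d) => s us sub n m hm; apply/eqP; rewrite -subr_eq0.
rewrite -[_ - _]/(symser_val (\sum_(i <- s | P i) u i - S) n m).
apply/eqP; apply: symser_eq0 hm => l hl; rewrite raddfB raddf_sum /= h ?subrr //.
by move=> k hk; apply/sub/mem_intparts_lt/(leq_ltn_trans hk).
Qed.

Lemma is_schurE l (F : mpfam R) : is_schur l F <-> is_groth 0 0 l F.
Proof.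
suff h n : \det (\matrix_(i < n, j < n)
    (mpser_var i ^+ (part l j + n - j.+1) * (1 + 0 *: mpser_var i) ^+ j
      / (1 - 0 *: mpser_var i) ^+ part l j)) =
    \det (\matrix_(i < n, j < n) mpser_var i ^+ (part l j + n - j.+1)) :> mpser n R.
  by split=> hF n /hF ->; rewrite h.
congr (\det _); apply/matrixP => i j; rewrite !mxE.
by rewrite !scale0r addr0 subr0 !expr1n mulr1 divr1.
Qed.

(** Every monomial of the alternant has the degree of [l] plus that of the staircase, so the
    quotient lives in the single degree [sumn l]. *)
Lemma schur_bounded l : SymSer (groth_fam_symser (0 : R) 0 l) \in symfun_pred (R := R).
Proof.
apply/asboolP; exists (sumn l).+1 => n m hm.
rewrite -[LHS]/(groth_fam 0 0 l n m).
have [h|h] := leqP (size l) n; last by rewrite /groth_fam leqNgt h.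
apply: (@mulr_vandermonde_eq0 _ _ _ (mdeg m)) => // m' hm'.
have /is_grothE -> // := @groth_fam_is_groth R 0 0 l.
rewrite alternant_coef /determinant big1 // => s _; apply/eqP.
rewrite mulf_eq0; apply/orP; right; apply/contraT => /prodf_neq0 nz.
have e (i : 'I_n) : m' i = (part l (s i) + (staircase n) (s i))%N.
  have := nz i isT; rewrite mxE /gser !scale0r addr0 subr0 !expr1n mulr1 divr1.
  rewrite -[X in cf X]mul1r cfMXn cf1 mnmE.
  case: ifP => [h1|_]; last by rewrite eqxx.
  have [e _|_] := eqVneq (m' i - (part l (s i) + n - (s i).+1))%N 0%N;
    last by rewrite eqxx.
  by have := ltn_ord (s i); lia.
move: hm; rewrite -(ltn_add2r (mdeg (staircase n))) -hm' [X in (_ < X)%N]mdegE.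
under eq_bigr do rewrite e.
rewrite big_split /= (sumn_part h) (mdegE (staircase n)).
have hr (F : 'I_n -> nat) : (\sum_i F (s i) = \sum_i F i)%N.
  by rewrite [RHS](reindex_inj (@perm_inj _ s)).
by rewrite (hr (fun i => part l i)) (hr (staircase n)) ltnn.
Qed.

Lemma schurE l : symser_val (symfun_val (schur l : symfun R)) = groth_fam 0 0 l.
Proof.
apply: is_groth_unique; first exact: symser_stable.
apply/is_schurE; rewrite /schur.
apply: (@xgetPex _ 0 [set F : symfun R | is_schur l F]%classic).
by exists (SymFun (schur_bounded l)); apply/is_schurE; apply: groth_fam_is_groth.
Qed.

Lemma scoord_schur l k : scoord k (schur l : symfun R) = (l == k)%:R.
Proof.
pose n := maxn (size l) (size k).
have hl : (size l <= n)%N by rewrite leq_maxl.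
have hk : (size k <= n)%N by rewrite leq_maxr.
rewrite (scoordE _ hk) /schur_coord schurE.
have /is_grothE -> // := @groth_fam_is_groth R 0 0 l.
rewrite alternant_coef.
have hM (i j : 'I_n) : cf (gser (0 : R) 0 l n j) (exponent n k i) =
    (part k i + j == part l j + i)%N%:R.
  rewrite /gser !scale0r addr0 subr0 !expr1n mulr1 divr1 -[X in cf X]mul1r cfMXn cf1 mnmE.
  have hi := ltn_ord i; have hj := ltn_ord j.
  by case: ifP => h; last (case: eqP => // e; lia); congr (_%:R); apply/eqP/eqP; lia.
rewrite (@det_unitriangular_pair _ _ (part k) (part l)) =>
  [|i|i|i j h1 h2|i j h1 h2|i h|i h];
  rewrite ?mxE ?hM.
- by rewrite part_eqP // eq_sym.
- exact: part_leS.
- exact: part_leS.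
- by case: eqP => // e; lia.
- by case: eqP => // e; lia.
- by case: eqP => // e; lia.
- by rewrite h eqxx.
Qed.

(** The coordinate at [l] only sees the component of degree [sumn l]; hence a partial sum correct
    below degree [(sumn l).+1] already has the right one. *)
Lemma sums_to_schur_unique (c : intpart -> R) S :
  sums_to xpredT (fun l => c l *: (schur l : symser R)) S -> forall l, c l = scoord l S.
Proof.
move=> h l; have [s0 hs] := h (sumn l).+1.
pose s := undup (l :: s0); have us : uniq s := undup_uniq _.
have hl : l \in s by rewrite mem_undup mem_head.
have sub : {subset s0 <= s} by move=> k hk; rewrite mem_undup in_cons hk orbT.
have -> : c l = scoord l (\sum_(k <- s) c k *: (schur k : symser R)).
  rewrite raddf_sum /= (bigD1_seq l) //= linearZ /= scoord_schur eqxx mulr1.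
  by rewrite big1 ?addr0 // => k ne; rewrite linearZ /= scoord_schur (negbTE ne) mulr0.
rewrite /scoord /schur_coord vandermonde_poly.
have e : mdeg (exponent (size l) l) = (sumn l + mdeg (staircase (size l)))%N.
  rewrite (sumn_part (leqnn _)) !mdegE -big_split; apply: eq_bigr => i _.
  by rewrite /= !mnmE addnBA.
rewrite !(mpserM_hompart _ (vdm_poly_homog _ _) e); congr ((_ * _)@__).
apply/mpolyP => m; rewrite !hompartE; case: eqP => // hm.
by rewrite hs // hm.
Qed.

Lemma sums_to_schur S : sums_to xpredT (fun l => scoord l S *: (schur l : symser R)) S.
Proof.
apply: sums_toP => l s us hs; rewrite (bigD1_seq l) ?hs //= linearZ /=.
rewrite scoord_schur eqxx mulr1 big1 ?addr0 // => k ne.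
by rewrite linearZ /= scoord_schur (negbTE ne) mulr0.
Qed.

Lemma schur_coefE S : schur_coef S = fun l => scoord l S.
Proof.
apply/funext => l; apply: sums_to_schur_unique l.
apply: (@xgetPex _ _ [set c : intpart -> R |
  sums_to xpredT (fun l => c l *: (schur l : symser R)) S]%classic).
by exists (fun l => scoord l S); apply: sums_to_schur.
Qed.

Lemma scoord_bounded (f : symfun R) :
  exists d, forall l, (d <= sumn l)%N -> scoord l f = 0.
Proof.
case: f => S hS; have /asboolP [d hd] := hS; exists d => l hl /=.
have e : mdeg (exponent (size l) l) = (sumn l + mdeg (staircase (size l)))%N.
  rewrite (sumn_part (leqnn _)) !mdegE -big_split; apply: eq_bigr => i _.
  by rewrite /= !mnmE addnBA.
rewrite /scoord /schur_coord vandermonde_poly.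
rewrite (mpserM_hompart _ (vdm_poly_homog _ _) e) (_ :
  hompart _ _ = 0) ?mul0r ?mcoeff0 //.
apply/mpolyP => m; rewrite hompartE mcoeff0; case: eqP => // hm.
by rewrite hd // hm.
Qed.

Lemma hallE (f : symfun R) (F : symser R) (d : nat) :
  (forall l, (d <= sumn l)%N -> scoord l f = 0) ->
  forall s, uniq s -> (forall l, (sumn l < d)%N -> l \in s) ->
  hall f F = \sum_(l <- s) scoord l f * scoord l F.
Proof.
move=> hd s us hs; rewrite /hall !schur_coefE [RHS]fsbig_seq //.
apply/esym/fsbig_widen => // l [_ hl] /=; rewrite hd ?mul0r // leqNgt.
by apply/negP => /hs.
Qed.

End Schur.

(** * The Cauchy-Binet formula over partitions in a box *)

Section Box.
Variables n M : nat.
Implicit Types l k : intpart.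

(** These numbers encode the partitions with at most [n] parts as sets of [n] naturals, those in the
    box as the subsets of size [n] of the first [n + M] naturals. They are the row selections of
    Cauchy-Binet. *)
Definition beta_number l (i : nat) : nat := (part l i + n - i.+1)%N.

Definition in_box l : bool := (size l <= n)%N && (part l 0 <= M)%N.

Definition box : seq intpart := [seq l <- undup (intparts_lt (n * M).+1) | in_box l].

Lemma box_uniq : uniq box. Proof. by rewrite filter_uniq ?undup_uniq. Qed.

Lemma mem_box l : (l \in box) = in_box l.
Proof.
rewrite mem_filter andb_idr // => /andP [h1 h2]; rewrite mem_undup mem_intparts_lt //.
rewrite ltnS (sumn_part h1) -[n in (_ <= n * _)%N]card_ord -sum_nat_const.
by apply: leq_sum => i _; apply: leq_trans (part_le _ _) h2.
Qed.

Lemma beta_number_lt l i : in_box l -> (i < n)%N -> (beta_number l i < n + M)%N.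
Proof.
move=> /andP [_ h] hi; have := part_le l (leq0n i); rewrite /beta_number; lia.
Qed.

Lemma beta_number_mono l i j : (i < j < n)%N -> (beta_number l j < beta_number l i)%N.
Proof.
move=> /andP [hij hj]; have := part_le l (ltnW hij); rewrite /beta_number; lia.
Qed.

Lemma perm_mono_id (t : 'S_n) :
  (forall i j : 'I_n, (i < j)%N -> (t i < t j)%N) -> t = 1%g.
Proof.
have key (u : 'S_n) : (forall i j : 'I_n, (i < j)%N -> (u i < u j)%N) ->
    forall i : 'I_n, (i <= u i)%N.
  move=> hu [i hi]; elim: i hi => //= i ih hi.
  exact: leq_ltn_trans (ih (ltnW hi)) (hu (Ordinal (ltnW hi)) (Ordinal hi) (leqnn _)).
move=> ht; apply/permP => i; rewrite perm1; apply/val_inj/eqP.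
rewrite eqn_leq key // andbT -{2}[i](permK t).
have tV : forall i j : 'I_n, (i < j)%N -> (t^-1%g i < t^-1%g j)%N.
  move=> j k hjk; rewrite ltnNge; apply/negP; rewrite leq_eqVlt => /predU1P [e|/ht].
    by move: hjk; rewrite (perm_inj (val_inj e)) ltnn.
  by rewrite !permKV ltnNge ltnW.
by have := key _ tV (t i).
Qed.

Lemma beta_number_inj l k (s t : 'S_n) : (size l <= n)%N -> (size k <= n)%N ->
  (forall i, beta_number l (s i) = beta_number k (t i)) -> l = k /\ s = t.
Proof.
move=> hl hk h; have e1 : (s^-1 * t)%g = 1%g.
  apply: perm_mono_id => i j hij; rewrite !permM ltnNge; apply/negP.
  have h' (u : 'I_n) : beta_number l u = beta_number k (t (s^-1 u)%g) by rewrite -h permKV.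
  rewrite leq_eqVlt => /predU1P [e|e].
    by move: hij; rewrite -(perm_inj (perm_inj (val_inj e))) ltnn.
  have := @beta_number_mono k _ _ (introT andP (conj e (ltn_ord _))).
  have := @beta_number_mono l _ _ (introT andP (conj hij (ltn_ord _))).
  by rewrite !h' => /ltnW; rewrite leqNgt => /negbTE ->.
have e2 : s = t by rewrite -[t]mul1g -(mulgV s) -mulgA e1 mulg1.
split=> //; apply: part_inj => i; have [hi|hi] := ltnP i n; last first.
  by rewrite !part_default // (leq_trans _ hi).
have := h (s^-1 (Ordinal hi))%g; rewrite -e2 permKV /beta_number /=; lia.
Qed.

Lemma beta_number_sort (f : {ffun 'I_n -> 'I_(n + M)}) : injective f ->
  exists l (s : 'S_n), in_box l /\ forall i, val (f i) = beta_number l (s i).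
Proof.
move=> inj; pose t : n.-tuple nat := [tuple val (f i) | i < n].
have hs : size (sort geq t) == n by rewrite size_sort size_tuple.
pose g := Tuple hs; have /tuple_permP [s es] : perm_eq t g by rewrite perm_sym perm_sort.
have ft i : val (f i) = tnth g (s i).
  have et : t = [tuple tnth g (s j) | j < n] by apply: val_inj.
  by have := congr1 (fun z => tnth z i) et; rewrite !tnth_mktuple.
have ug : uniq g by rewrite sort_uniq; apply/tuple_uniqP => i j;
  rewrite !tnth_mktuple => /val_inj /inj.
have sg : sorted gtn g.
  rewrite gtn_sorted_uniq_geq ug /=; apply: sort_sorted => x y; exact: leq_total.
have gd (i j : 'I_n) : (i < j)%N -> (tnth g j < tnth g i)%N.
  move=> hij; rewrite !(tnth_nth 0%N).
  apply: (sorted_ltn_nth _ _ sg) => //; rewrite ?inE ?size_tuple //.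
  by move=> x y z h1 h2; apply: ltn_trans h2 h1.
have gn i : (tnth g i < n + M)%N.
  by have := ft (s^-1 i)%g; rewrite permKV => <-; apply: ltn_ord.
(* Subtracting the staircase from strictly decreasing naturals leaves the parts of a partition. *)
pose m : 'X_{1..n} := [multinom tnth g i - (n - i.+1) | i < n].
have gl (i : 'I_n) : (n - i.+1 <= tnth g i)%N.
  have [d hd] := ubnP (n - i.+1)%N; elim: d i hd => // d ih i hd.
  have [hi|hi] := ltnP i.+1 n; last by move: hi; rewrite -subn_eq0 => /eqP ->.
  have := ih (Ordinal hi) _; have := gd i (Ordinal hi) (leqnn _) => /=; lia.
have md (i j : 'I_n) : (i <= j)%N -> (m j <= m i)%N.
  rewrite leq_eqVlt => /predU1P [/val_inj -> //|hij]; rewrite !mnmE.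
  have h (d : nat) (k : 'I_n) : (k = i + d :> nat)%N -> (tnth g k + d <= tnth g i)%N.
    elim: d k => [|d ih] k ek; first by rewrite addn0 (_ : k = i) //; apply: val_inj;
      rewrite /= ek addn0.
    have hk' : (i + d < n)%N by have := ltn_ord k; lia.
    have := ih (Ordinal hk') erefl; have := gd (Ordinal hk') k; rewrite /=; lia.
  have := h (j - i)%N j; have := ltn_ord j; have := gl j; have := gl i; lia.
have [l [hl lm _]] := intpart_of_mnm md; exists l, s; split=> [|i].
  rewrite /in_box hl /=; have [n0|np] := posnP n.
    by rewrite part_default // -n0.
  by rewrite (lm (Ordinal np)) mnmE /=; have := gn (Ordinal np); lia.
by rewrite ft /beta_number lm mnmE -addnBA // subnK.
Qed.

(** Multilinearity in the rows gives a sum over all maps [f]. A map that is not injective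
    contributes a determinant with two equal rows; an injective one is, in a unique way, a
    permutation followed by the beta numbers of a partition, and the sum over the permutations
    rebuilds the first determinant. *)
Lemma det_Cauchy_Binet (R : comNzRingType) (A : 'I_n -> nat -> R) (B : nat -> 'I_n -> R) :
  \det (\matrix_(i, j) \sum_(e < n + M) A i e * B e j) =
  \sum_(l <- box) \det (\matrix_(i, k) A i (beta_number l k)) *
                  \det (\matrix_(k, j) B (beta_number l k) j).
Proof.
pose D (f : {ffun 'I_n -> 'I_(n + M)}) := \det (\matrix_(k, j) B (f k) j).
transitivity (\sum_(f : {ffun 'I_n -> 'I_(n + M)}) (\prod_i A i (f i)) * D f).
  rewrite /determinant; under [RHS]eq_bigr do rewrite mulr_sumr.
  rewrite exchange_big; apply: eq_bigr => s _.
  under eq_bigr do rewrite mxE.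
  rewrite bigA_distr_bigA mulr_sumr; apply: eq_bigr => f _ /=.
  rewrite mulrCA -big_split; congr (_ * _); apply: eq_bigr => i _.
  by rewrite mxE.
transitivity (\sum_(f : {ffun 'I_n -> 'I_(n + M)}) \sum_(l <- box) \sum_(s : 'S_n)
    if [forall i, val (f i) == beta_number l (s i)] then (\prod_i A i (f i)) * D f else 0).
  apply: eq_bigr => f _; have [/injectiveP inj|ninj] := boolP (injectiveb f).
    move: (_ * D f) => c.
    have [l [s [hl hs]]] := beta_number_sort inj.
    have lb : l \in box by rewrite mem_box.
    rewrite (bigD1_seq l) ?box_uniq //= (bigD1 s) //= ifT; last first.
      by apply/forallP => i; apply/eqP/hs.
    rewrite big1 => [|t nt]; last first.
      rewrite ifF //; apply/negP => /forallP h; case/eqP: nt.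
      have /andP [hl1 _] := hl.
      have hi i : beta_number l (t i) = beta_number l (s i) by rewrite -hs;
        apply/esym/eqP/h.
      by have [_ ->] := beta_number_inj hl1 hl1 hi.
    rewrite addr0 big_seq_cond big1 ?addr0 // => k /andP [hk nk]; rewrite big1 // => t _.
    rewrite ifF //; apply/negP => /forallP h; case/eqP: nk; move: hk;
      rewrite mem_box => /andP [hk1 _].
    have /andP [hl1 _] := hl.
    have hi i : beta_number k (t i) = beta_number l (s i) by rewrite -hs;
      apply/esym/eqP/h.
    by have [-> _] := beta_number_inj hk1 hl1 hi.
  have D0 : D f = 0.
    have /injectivePn [i [j nij eij]] := ninj.
    by apply: (determinant_alternate nij) => k; rewrite !mxE eij.
  rewrite D0 mulr0; apply/esym/big1 => l _; apply: big1 => s _; exact: if_same.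
rewrite exchange_big /= big_seq [RHS]big_seq; apply: eq_bigr => l; rewrite mem_box => lb.
rewrite exchange_big /= mulr_suml; apply: eq_bigr => s _.
pose f := [ffun i => Ordinal (beta_number_lt lb (ltn_ord (s i)))].
rewrite (bigD1 f) //= [X in _ + X]big1 ?addr0 => [|g ng]; last first.
  rewrite ifF //; apply/negP => /forallP h; case/eqP: ng; apply/ffunP => i; apply:
    val_inj.
  by rewrite ffunE /=; apply/eqP.
rewrite ifT; last by apply/forallP => i; rewrite ffunE.
have -> : \prod_i A i (f i) = \prod_i (\matrix_(i0, k) A i0 (beta_number l k)) i (s i).
  by apply: eq_bigr => i _; rewrite mxE ffunE.
rewrite -mulrA mulrCA; congr (_ * _).
have -> : D f = \det (row_perm s (\matrix_(k, j) B (beta_number l k) j)).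
  by congr (\det _); apply/matrixP => i j; rewrite !mxE ffunE.
by rewrite row_permE det_mulmx det_perm.
Qed.

End Box.

(** * The inverse of the Schur expansion matrix *)

Section Duality.
Variables (R : idomainType) (a b : R).
Local Notation ser := (mpser 1 R).
Local Notation X := (mpser_var (@ord0 0) : ser).
Local Notation A := (1 - a *: X : ser).
Local Notation Gam := (1 - (a + b) *: X : ser).
Implicit Types l k mu nu : intpart.

(** Indices start at 0, which turns the exponents 1 - i and j - nu_j - 1 of the numbering from 1
    into -i and j - nu_j. *)
Definition jt_entry mu nu (i j : nat) : R :=
  if (part nu j + i <= part mu i + j)%N
  then cf (A ^ (j%:Z - (part nu j)%:Z) / Gam ^+ i) (part mu i + j - (part nu j + i))
  else 0.

Definition jt_det n mu nu : R := \det (\matrix_(i < n, j < n) jt_entry mu nu i j).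

Let unitA : A \is a GRing.unit. Proof. exact: mpser_geom_unit. Qed.
Let unitG : Gam \is a GRing.unit. Proof. exact: mpser_geom_unit. Qed.

(** Because j - nu_j is n - 1 minus the beta number, [nu] enters only through a power of [X / A].
    This is the dependence on the summation index that Cauchy-Binet requires. *)
Lemma jt_entryE n mu nu (i j : 'I_n) : jt_entry mu nu i j =
  cf (A ^+ n.-1 / Gam ^+ i * (X / A) ^+ beta_number n nu j) (beta_number n mu i).
Proof.
have hi := ltn_ord i; have hj := ltn_ord j.
have -> : A ^+ n.-1 / Gam ^+ i * (X / A) ^+ beta_number n nu j =
    A ^ (j%:Z - (part nu j)%:Z) / Gam ^+ i * X ^+ beta_number n nu j.
  have -> : A ^ (j%:Z - (part nu j)%:Z) = A ^+ n.-1 / A ^+ beta_number n nu j.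
    rewrite -[A ^+ n.-1]/(A ^ n.-1) -[A ^+ beta_number _ _ _]/(A ^ beta_number n nu j).
    rewrite invr_expz -exprzDr //; congr (_ ^ _).
    rewrite /beta_number; lia.
  rewrite exprMn exprVn; set P := _^-1; set Q := _^-1; set U := X ^+ _.
  by ring.
rewrite cfMXn /jt_entry /beta_number.
have -> : (part nu j + n - j.+1 <= part mu i + n - i.+1)%N =
    (part nu j + i <= part mu i + j)%N.
  by apply/idP/idP; lia.
by case: ifP => h //; congr cf; lia.
Qed.

(* The series obtained from [f] by the substitution of [X / (1 - a X)] for [X]. *)
Definition mobius_subst (f : ser) : ser := fun m =>
  \sum_(e < (m ord0).+1) cf ((X / A) ^+ e) (m ord0) * cf f e.

Lemma cf_mobius f p : cf (mobius_subst f) p = \sum_(e < p.+1) cf ((X / A) ^+ e) p * cf f e.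
Proof. by rewrite /cf /mobius_subst mulmnE mnm1E mul1n. Qed.

Lemma cf_powU (h : ser) e p : (p < e)%N -> cf (h * (X / A) ^+ e) p = 0.
Proof. by move=> hp; rewrite exprMn mulrCA mulrC cfMXn leqNgt hp. Qed.

(** The series [(X / A) ^+ e] starts in degree [e], so every bound beyond [p] gives the full sum; a
    bound independent of [p] is what a matrix product needs. *)
Lemma cfM_mobius (h f : ser) p N : (p < N)%N ->
  cf (h * mobius_subst f) p = \sum_(e < N) cf (h * (X / A) ^+ e) p * cf f e.
Proof.
move=> hp; rewrite cfM.
have e1 (i : 'I_p.+1) : cf h i * cf (mobius_subst f) (p - i) =
    \sum_(e < N) cf h i * cf ((X / A) ^+ e) (p - i) * cf f e.
  rewrite cf_mobius (big_ord_widen N (fun e => cf ((X / A) ^+ e) (p - i) * cf f e));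
    last lia.
  rewrite big_mkcond mulr_sumr; apply: eq_bigr => e _; case: ifP => he;
    first by rewrite mulrA.
  by rewrite mulr0 -[_ ^+ e]mul1r cf_powU ?mulr0 ?mul0r // ltnNge -ltnS he.
rewrite (eq_bigr _ (fun i _ => e1 i)) exchange_big; apply: eq_bigr => e _ /=.
by rewrite cfM mulr_suml.
Qed.

Lemma mobius_substB f g : mobius_subst (f - g) = mobius_subst f - mobius_subst g.
Proof.
apply: cfP => p; rewrite cfB !cf_mobius -sumrB; apply: eq_bigr => e _.
by rewrite cfB mulrBr.
Qed.

Lemma mobius_substZ c f : mobius_subst (c *: f) = c *: mobius_subst f.
Proof.
apply: cfP => p; rewrite cfZ !cf_mobius mulr_sumr; apply: eq_bigr => e _.
by rewrite cfZ mulrCA.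
Qed.

Lemma mobius_substX f : mobius_subst (f * X) = X / A * mobius_subst f.
Proof.
apply: cfP => p; rewrite (cfM_mobius _ _ (ltnSn p)) cf_mobius big_ord_recl cfMX mulr0 add0r.
rewrite [RHS]big_ord_recr /= -exprS -[_ ^+ p.+1]mul1r cf_powU // mul0r addr0.
by apply: eq_bigr => e _; rewrite cfMX /= /bump -exprS.
Qed.

Lemma mobius_subst1 : mobius_subst 1 = 1.
Proof.
apply: cfP => p; rewrite cf_mobius big_ord_recl expr0 !cf1 mulr1 big1 ?addr0 // => e _.
by rewrite cf1 mulr0.
Qed.

(** At x = X / A one has 1 - b x = (A - b X) / A, and A - b X is [Gam]. *)
Lemma mobius_substM1b f : mobius_subst (f * (1 - b *: X)) = Gam / A * mobius_subst f.
Proof.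
rewrite mulrBr mulr1 mobius_substB [f * (b *: X)]mulrC -scalerAl [X * f]mulrC.
rewrite mobius_substZ mobius_substX scalerAl -[Z in Z - _]mul1r -mulrBl; congr (_ * _).
rewrite -[Z in Z - _ = _](divrr unitA) scalerAl -mulrBl; congr (_ / _).
by rewrite scalerDl opprD addrA.
Qed.

(** At x = X / A one has 1 + a x = (A + a X) / A = 1 / A. *)
Lemma mobius_substM1a f : mobius_subst (f * (1 + a *: X)) = A^-1 * mobius_subst f.
Proof.
rewrite (_ : 1 + _ = 1 - (- a) *: X :> ser); last by rewrite scaleNr opprK.
rewrite mulrBr mulr1 mobius_substB [f * (- a *: X)]mulrC.
rewrite -scalerAl [X * f]mulrC mobius_substZ mobius_substX scalerAl.
rewrite -[Z in Z - _]mul1r -mulrBl; congr (_ * _).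
rewrite scaleNr opprK -[Z in Z + _ = _](divrr unitA) scalerAl -mulrDl.
by rewrite -addrA addNr addr0 mul1r.
Qed.

(** The substitution produces A to the power part - beta - j, which is 1 - n for every column; the
    factor [A ^+ n.-1] removes it. *)
Lemma mobius_subst_gser n l (j : 'I_n) :
  A ^+ n.-1 * mobius_subst (gser (- a) (- b) l n j) =
  X ^+ beta_number n l j * Gam ^+ j.
Proof.
have hj := ltn_ord j.
have unit1 : 1 + a *: X \is a GRing.unit.
  by rewrite -[a *: X]opprK -scaleNr mpser_geom_unit.
(* The denominator of [gser] is moved to the other side, because the substitution has only been
   computed for products with X, 1 - b X and 1 + a X. *)
have hT f c d e : (1 + a *: X) ^+ d * f = (1 - b *: X) ^+ e * X ^+ c ->
    mobius_subst f = A ^+ d * (Gam / A) ^+ e * (X / A) ^+ c.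
  move=> ef.
  have e1 h q : mobius_subst ((1 + a *: X) ^+ q * h) = A^-1 ^+ q * mobius_subst h.
    by elim: q => [|q ih];
      rewrite ?mul1r // exprSr -mulrA -[_ * h]mulrC mulrA mobius_substM1a
      ih exprS mulrA.
  have e2 h q : mobius_subst ((1 - b *: X) ^+ q * h) = (Gam / A) ^+ q * mobius_subst h.
    by elim: q => [|q ih];
      rewrite ?mul1r // exprSr -mulrA -[_ * h]mulrC mulrA mobius_substM1b
      ih exprS mulrA.
  have e3 q : mobius_subst (X ^+ q) = (X / A) ^+ q.
    by elim: q => [|q ih]; rewrite ?mobius_subst1 // exprSr mobius_substX ih exprS.
  have := e1 f d; rewrite ef e2 e3 exprVn => e4.
  by rewrite -mulrA e4 mulVKr // unitrX.
rewrite (hT _ (beta_number n l j) (part l j) j); last first.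
  by rewrite /gser !scaleNr opprK mulrC divrK ?unitrX // mulrC.
rewrite !exprMn !exprVn; set c := beta_number n l j.
have e : A ^+ n.-1 * A ^+ part l j = A ^+ j * A ^+ c.
  by rewrite -!exprD /c /beta_number; congr (_ ^+ _); lia.
have e' : A ^+ n.-1 * A ^+ part l j * ((A ^+ j)^-1 * (A ^+ c)^-1) = 1.
  by rewrite e mulrACA !divrr ?mul1r // unitrX.
rewrite -[RHS]mul1r -[Z in _ = Z * _]e'; set P := _^-1; set Q := _^-1; ring.
Qed.

Lemma cf_exp_eq0 c d (k : nat) : (d < k)%N -> cf ((1 - c *: X) ^+ d) k = 0.
Proof.
elim: d k => [|d ih] [|k] // hk; first by rewrite cf1.
rewrite exprSr mulrBr mulr1 cfB [_ * (c *: X)]mulrC -scalerAl cfZ [X * _]mulrC cfMX.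
by rewrite !ih ?mulr0 ?subrr // ltnW.
Qed.

(** The zero block has n - p rows and p + 1 columns. A permutation avoiding it would inject the
    indices from p on into those beyond p. *)
Lemma det_zero_block n (M : 'M[R]_n) (p : nat) : (p < n)%N ->
  (forall i j : 'I_n, (j <= p <= i)%N -> M i j = 0) -> \det M = 0.
Proof.
move=> hp h; rewrite /determinant big1 // => s _; apply/eqP; rewrite mulf_eq0.
apply/orP; right; apply/prodf_eq0.
suff [i hi] : exists i, (s i <= p <= i)%N by exists i => //; rewrite h.
apply/existsP/contraT; rewrite negb_exists => /forallP hs.
pose D := [set i : 'I_n | (p <= i)%N]%SET; pose E := [set i : 'I_n | (p < i)%N]%SET.
have sub : (s @: D)%SET \subset E.
  apply/fintype.subsetP => _ /imsetP [i hi ->]; move: hi (hs i); rewrite !inE => ->.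
  by rewrite andbT -ltnNge.
have := subset_leq_card sub; rewrite card_imset; last exact: perm_inj.
have ED : E \proper D.
  apply/properP; split; first by apply/fintype.subsetP => i; rewrite !inE; apply: ltnW.
  by exists (Ordinal hp); rewrite !inE /= ?ltnn.
by rewrite leqNgt (proper_card ED).
Qed.

Lemma subpartPn nu mu : ~~ subpart nu mu ->
  exists2 p, (p < size nu)%N & (part mu p < part nu p)%N.
Proof.
move=> h; have /allPn [p hp1 hp2] := h; exists p; last by rewrite ltnNge.
by move: hp1; rewrite mem_iota.
Qed.

Lemma beta_number_block n nu mu p i j : (p < n)%N -> (part mu p < part nu p)%N ->
  (j <= p <= i)%N -> (i < n)%N -> (beta_number n mu i < beta_number n nu j)%N.
Proof.
move=> hp hlt /andP [hj hi] hin; rewrite /beta_number.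
have := part_le mu hi; have := part_le nu hj; lia.
Qed.

(** A row [p] where the part of [nu] exceeds that of [mu] produces a zero block. With the same fact
    for the G, both transition matrices are triangular for inclusion, which makes all later sums
    finite. *)
Lemma jt_det_eq0 n mu nu : (size nu <= n)%N -> ~~ subpart nu mu -> jt_det n mu nu = 0.
Proof.
move=> hn /subpartPn [p hp hlt]; have hpn := leq_trans hp hn.
apply: (det_zero_block hpn) => i j hij; rewrite mxE jt_entryE cf_powU //.
exact: beta_number_block hpn hlt hij (ltn_ord i).
Qed.

Local Notation gcoord nu l := (scoord l (groth (- a) (- b) nu)).

Lemma gcoordE n nu l : (size nu <= n)%N -> (size l <= n)%N ->
  gcoord nu l = \det (\matrix_(i < n, j < n)
    cf (gser (- a) (- b) nu n j) (beta_number n l i)).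
Proof. by move=> h1 h2; rewrite (scoordE _ h2) schur_coord_groth. Qed.

Lemma gcoord_eq0 nu l : ~~ subpart nu l -> gcoord nu l = 0.
Proof.
pose n := maxn (size nu) (size l).
have hn : (size nu <= n)%N by rewrite leq_maxl.
have hl : (size l <= n)%N by rewrite leq_maxr.
move=> /subpartPn [p hp hlt]; have hpn := leq_trans hp hn.
rewrite (gcoordE hn hl); apply: (det_zero_block hpn) => i j hij; rewrite mxE.
rewrite /gser -/(beta_number n nu j) -mulrA mulrC cfMXn leqNgt.
by rewrite (beta_number_block hpn hlt hij (ltn_ord i)).
Qed.

(** Cauchy-Binet merges the two determinants, and the substitution cancels all powers of [A]: the
    entries become coefficients of [Gam ^+ j / Gam ^+ i] times a power of X. *)
Lemma jt_det_gcoord n M mu nu : in_box n M mu -> in_box n M nu ->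
  \sum_(l <- box n M) jt_det n mu l * gcoord nu l = (mu == nu)%:R.
Proof.
move=> hmu hnu; have /andP [hmun hmuM] := hmu; have /andP [hnun _] := hnu.
pose L (i : 'I_n) e := cf (A ^+ n.-1 / Gam ^+ i * (X / A) ^+ e) (beta_number n mu i).
pose G e (j : 'I_n) := cf (gser (- a) (- b) nu n j) e.
transitivity (\sum_(l <- box n M) \det (\matrix_(i, k) L i (beta_number n l k)) *
                  \det (\matrix_(k, j) G (beta_number n l k) j)).
  rewrite big_seq [RHS]big_seq; apply: eq_bigr => l; rewrite mem_box => /andP [hl _].
  rewrite (gcoordE hnun hl); congr (\det _ * _); apply/matrixP => i k.
  by rewrite !mxE jt_entryE.
rewrite -det_Cauchy_Binet.
have hM (i j : 'I_n) : \sum_(e < n + M) L i e * G e j =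
    cf (Gam ^+ j / Gam ^+ i * X ^+ beta_number n nu j) (beta_number n mu i).
  rewrite -cfM_mobius ?beta_number_lt // mulrAC mobius_subst_gser.
  by rewrite -[Z in cf Z _ = _]mulrA [X ^+ _ * _]mulrC.
rewrite (@det_unitriangular_pair _ _ (part mu) (part nu)) =>
  [|i|i|i j h1 h2|i j h1 h2|i h|i h];
  rewrite ?mxE ?hM.
- by rewrite part_eqP.
- exact: part_leS.
- exact: part_leS.
(* On and above the diagonal the series is a polynomial of degree at most j - i, less than the
   required degree when the part of [nu] is smaller than that of [mu]. *)
- have -> : Gam ^+ j / Gam ^+ i = Gam ^+ (j - i).
    by rewrite -{1}(subnK h1) exprD mulrK // unitrX.
  rewrite cfMXn; case: ifP => // hle; apply: cf_exp_eq0; move: hle.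
  by rewrite /beta_number; have := ltn_ord i; have := ltn_ord j; lia.
- rewrite cfMXn leqNgt ifF //; apply/negbTE; rewrite negbK /beta_number.
  by have := ltn_ord i; have := ltn_ord j; lia.
- rewrite cfMXn leqNgt ifF //; apply/negbTE; rewrite negbK /beta_number.
  by have := ltn_ord i; lia.
- by rewrite /beta_number h divrr ?unitrX // cfMXn leqnn subnn cf1 eqxx.
Qed.

(** Both matrices, indexed by the finite box, are square, so the one-sided inverse is two-sided. *)
Lemma gcoord_jt_det n M mu l : in_box n M mu -> in_box n M l ->
  \sum_(nu <- box n M) jt_det n nu mu * gcoord nu l = (mu == l)%:R.
Proof.
move=> hmu hl; pose N := size (box n M); pose x0 := IntPart (isT : is_intpart [::]).
pose B (p : 'I_N) := nth x0 (box n M) p.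
have hB p : in_box n M (B p) by rewrite -mem_box mem_nth.
have sumB (F : intpart -> R) : \sum_(nu <- box n M) F nu = \sum_(p < N) F (B p).
  by rewrite (big_nth x0) big_mkord.
pose F : 'M[R]_N := \matrix_(p, q) jt_det n (B p) (B q).
pose C : 'M[R]_N := \matrix_(q, p) gcoord (B p) (B q).
have FC : F *m C = 1%:M.
  apply/matrixP => p q; rewrite !mxE.
  under eq_bigr do rewrite !mxE.
  rewrite -(sumB (fun l => jt_det n (B p) l * gcoord (B q) l)) jt_det_gcoord //.
  by rewrite /B nth_uniq ?box_uniq.
have hi k : in_box n M k -> exists p : 'I_N, k = B p.
  rewrite -mem_box => hk; have hk' : (index k (box n M) < N)%N by rewrite index_mem.
  by exists (Ordinal hk'); rewrite /B /= nth_index.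
have [p ep] := hi _ hmu; have [q eq] := hi _ hl.
rewrite sumB; have := congr1 (fun Z : 'M[R]_N => Z q p) (mulmx1C FC).
rewrite !mxE ep eq (_ : (B p == B q) = (q == p)) => [<-|].
  by apply: eq_bigr => r _; rewrite !mxE mulrC.
by rewrite /B nth_uniq ?box_uniq // eq_sym.
Qed.

End Duality.

(** * Non-intersecting walkers *)

Section Walkers.
Variables (R : comNzRingType) (n : nat).
Variable w : int -> int -> R.
Local Notation ntrue := (count id).

Fixpoint walk_weight (t x : int) (s : seq bool) : R :=
  if s is c :: s' then (if c then w t x else 1) * walk_weight (t + 1) (x + c%:Z) s' else 1.

Definition walk_sum r t x z : R :=
  \sum_(s : r.-tuple bool | x + (ntrue s)%:Z == z) walk_weight t x s.

Lemma walk_sum0 t x z : walk_sum 0 t x z = (x == z)%:R.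
Proof.
rewrite /walk_sum (eq_bigl (fun=> x == z)) => [|s]; last by rewrite tuple0 addr0.
case: eqP => _; last by rewrite big_pred0_eq.
rewrite (big_pred1 [tuple]) // => s; by apply/esym/eqP; rewrite [LHS]tuple0.
Qed.

Lemma walk_sumS r t x z : walk_sum r.+1 t x z =
  \sum_(c : bool) (if c then w t x else 1) * walk_sum r (t + 1) (x + c%:Z) z.
Proof.
rewrite /walk_sum; under [RHS]eq_bigr do rewrite mulr_sumr.
rewrite pair_big_dep /=.
pose h (p : bool * r.-tuple bool) : r.+1.-tuple bool := [tuple of p.1 :: p.2].
rewrite (reindex h); last first.
  exists (fun s => (thead s, [tuple of behead s])) => [[c s] _|s _] /=.
    by congr pair; apply: val_inj.
  by apply: val_inj; case/tupleP: s.
by apply: eq_big => [[c s]|[c s] _] //=; rewrite PoszD addrA.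
Qed.

Definition walk_pos (x : int) (s : seq bool) (k : nat) : int := x + (ntrue (take k s))%:Z.

Definition increasing (p : 'I_n -> int) : bool :=
  [forall i : 'I_n, forall j : 'I_n, (i < j)%N ==> (p i < p j)].

Lemma increasingP p : reflect (forall i j : 'I_n, (i < j)%N -> p i < p j) (increasing p).
Proof.
apply: (iffP forallP) => [h i j hij|h i]; first by have /forallP/(_ j) := h i;
  rewrite hij.
by apply/forallP => j; apply/implyP/h.
Qed.

Definition noncrossing r (p : 'I_n -> int) (B : {ffun 'I_n -> r.-tuple bool}) : bool :=
  [forall k : 'I_r.+1, increasing (fun i => walk_pos (p i) (B i) k)].

Lemma det_sum_rows (I : finType) (F : 'I_n -> I -> R) (G : 'I_n -> I -> 'I_n -> R) :
  \det (\matrix_(i, j) \sum_c F i c * G i c j) =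
  \sum_(f : {ffun 'I_n -> I}) (\prod_i F i (f i)) * \det (\matrix_(i, j) G i (f i) j).
Proof.
rewrite /determinant; under [RHS]eq_bigr do rewrite mulr_sumr.
rewrite exchange_big; apply: eq_bigr => s _.
under eq_bigr do rewrite mxE.
rewrite bigA_distr_bigA mulr_sumr; apply: eq_bigr => f _ /=.
rewrite mulrCA -big_split; congr (_ * _); apply: eq_bigr => i _.
by rewrite mxE.
Qed.

(** A permutation matching two strictly increasing sequences is itself increasing, hence the
    identity. *)
Lemma det_eq_positions (p z : 'I_n -> int) : increasing p -> increasing z ->
  \det (\matrix_(i, j) (p i == z j)%:R) = [forall i, p i == z i]%:R :> R.
Proof.
move=> /increasingP hp /increasingP hz; rewrite /determinant (bigD1 1%g) //= odd_perm1.
rewrite expr0 mul1r [Z in _ + Z]big1 ?addr0 => [|s ns]; last first.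
  have [i hi|h] := pickP (fun i => p i != z (s i)).
    by rewrite (bigD1 i) //= mxE (negbTE hi) mul0r mulr0.
  case/eqP: ns; apply: perm_mono_id => i j hij; rewrite ltnNge; apply/negP.
  have e k : p k = z (s k) by apply/eqP; have := h k => /negbT; rewrite negbK.
  have := hp _ _ hij; rewrite !e leq_eqVlt => hlt /predU1P [/val_inj eq|/hz].
    by rewrite eq ltxx in hlt.
  by move=> /(lt_trans hlt); rewrite ltxx.
under eq_bigr do rewrite mxE perm1.
case: forallP => [h|h]; first by rewrite big1 // => i _; rewrite h.
have [i hi|h'] := pickP (fun i => p i != z i).
  by rewrite (bigD1 i) //= (negbTE hi) mul0r.
by case: h => i; apply: negbFE; apply: h'.
Qed.

(* Walkers that start in order and move by at most one step at a time either stay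
   in order or two of them meet, in which case two rows are equal. *)
Lemma det_walk_sum r t (p z : 'I_n -> int) : increasing p -> increasing z ->
  \det (\matrix_(i, j) walk_sum r t (p i) (z j)) =
  \sum_(B : {ffun 'I_n -> r.-tuple bool} |
      noncrossing p B && [forall i, p i + (ntrue (B i))%:Z == z i])
    \prod_i walk_weight t (p i) (B i).
Proof.
move=> hp hz; elim: r t p hp => [|r ih] t p hp.
  under eq_mx do rewrite walk_sum0.
  rewrite det_eq_positions //.
  have [B0 hB0] : exists B0 : {ffun 'I_n -> 0.-tuple bool}, forall B, B = B0.
    exists (finfun (fun=> in_tuple [::])) => B; apply/ffunP => i.
    by rewrite [LHS]tuple0 [RHS]tuple0.
  have nil0 i : tval (B0 i) = [::] by case: (B0 i) => [[]].
  rewrite big_mkcond (big_pred1 B0) => [|B]; last by rewrite /= (hB0 B) eqxx.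
  rewrite big1 => [|i _]; last by rewrite nil0.
  have -> : noncrossing p B0.
    apply/forallP => k; apply/increasingP => i j hij; rewrite /walk_pos !nil0 !addr0.
    by move/increasingP: hp; apply.
  have -> : [forall i, p i + (ntrue (B0 i))%:Z == z i] = [forall i, p i == z i].
    by apply: eq_forallb => i; rewrite nil0 addr0.
  by case: [forall i, _].
under eq_mx do rewrite walk_sumS.
rewrite (det_sum_rows (fun i c => if c then w t (p i) else 1)
  (fun i c j => walk_sum r (t + 1) (p i + c%:Z) (z j))).
pose h (q : {ffun 'I_n -> bool} * {ffun 'I_n -> r.-tuple bool}) :
    {ffun 'I_n -> r.+1.-tuple bool} := [ffun i => [tuple of q.1 i :: q.2 i]].
rewrite (reindex h); last first.
  exists (fun B : {ffun 'I_n -> r.+1.-tuple bool} => ([ffun i => thead (B i)],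
    [ffun i => [tuple of behead (B i)] : r.-tuple bool])).
    move=> [f B] _; congr pair; apply/ffunP => i; rewrite !ffunE //=.
    exact: val_inj.
  move=> B _; apply/ffunP => i; rewrite !ffunE /=; apply: val_inj.
  by case/tupleP: (B i).
transitivity (\sum_(f : {ffun 'I_n -> bool}) \sum_(B : {ffun 'I_n -> r.-tuple bool})
    if noncrossing p (h (f, B)) && [forall i, p i + (ntrue (h (f, B) i))%:Z == z i]
    then \prod_i walk_weight t (p i) (h (f, B) i) else 0); last first.
  by rewrite pair_bigA [RHS]big_mkcond; apply: eq_bigr => -[f B] _.
(* [f] records which walkers move in the first step and [q] their positions after it. *)
apply: eq_bigr => f _; pose q i := p i + (f i)%:Z.
have hnc (B : {ffun 'I_n -> r.-tuple bool}) : noncrossing p (h (f, B)) = noncrossing q B.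
  apply/forallP/forallP => hB k.
    have := hB (lift ord0 k); congr is_true; apply: eq_forallb => i; apply:
      eq_forallb => j.
    by rewrite /walk_pos !ffunE /= !PoszD !addrA.
  case: (unliftP ord0 k) => [k'|] ->.
    have := hB k'; congr is_true; apply: eq_forallb => i; apply: eq_forallb => j.
    by rewrite /walk_pos !ffunE /= !PoszD !addrA.
  apply/increasingP => i j hij; rewrite /walk_pos !take0 !addr0.
  by move/increasingP: hp; apply.
have hend (B : {ffun 'I_n -> r.-tuple bool}) :
    [forall i, p i + (ntrue (h (f, B) i))%:Z == z i] =
    [forall i, q i + (ntrue (B i))%:Z == z i].
  by apply: eq_forallb => i; rewrite ffunE /= PoszD addrA.
rewrite (eq_bigr (fun B => (\prod_i (if f i then w t (p i) else 1)) *
  (if noncrossing q B && [forall i, q i + (ntrue (B i))%:Z == z i]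
   then \prod_i walk_weight (t + 1) (q i) (B i) else 0))); last first.
  move=> B _; rewrite hnc hend; case: ifP => _; last by rewrite mulr0.
  by rewrite -big_split; apply: eq_bigr => i _; rewrite ffunE.
rewrite -mulr_sumr; congr (_ * _).
have [hq|hq] := boolP (increasing q); first by rewrite (ih (t + 1) q hq) big_mkcond.
have [i [j [hij hle]]] : exists i j : 'I_n, (i < j)%N /\ q j <= q i.
  move: hq; rewrite /increasing negb_forall => /existsP [i]; rewrite negb_forall =>
    /existsP [j].
  by rewrite negb_imply -leNgt => /andP [? ?]; exists i, j.
(* The order can only be lost if the left walker moves onto its neighbour, which stays, since a step
   has length at most 1. *)
have eq : q i = q j.
  have := increasingP _ hp _ _ hij; move: hle; rewrite /q.
  by case: (f i); case: (f j) => /=; lia.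
rewrite (determinant_alternate (i1 := i) (i2 := j)) => [||k]; last first.
- by rewrite !mxE -/(q i) -/(q j) eq.
- by rewrite -val_eqE /= ltn_eqF.
rewrite big1 // => B _; rewrite ifF //; apply/negP => /andP [/forallP /(_ ord0)].
by move=> /increasingP /(_ _ _ hij); rewrite /walk_pos !take0 !addr0 eq ltxx.
Qed.

End Walkers.

(** * Weighted path counts *)

Section ClosedForm.
Variables (R : idomainType) (a b : R).
Local Notation ser := (mpser 1 R).
Local Notation X := (mpser_var (@ord0 0) : ser).
Local Notation A := (1 - a *: X : ser).
Local Notation B := (1 - b *: X : ser).
Local Notation Gam := (1 - (a + b) *: X : ser).
Implicit Types (t x z k : int).

Definition cfz (f : ser) k : R := if k is Posz m then cf f m else 0.

Lemma cfz_lt0 f k : k < 0 -> cfz f k = 0. Proof. by case: k. Qed.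

(** This has the shape of the recursion for paths: a walker stays, which multiplies the series by 1
    - c X, or moves with weight [c], which lowers the remaining distance [k] by 1. *)
Lemma cfzB (c : R) (f : ser) k :
  cfz f k = cfz (f * (1 - c *: X)) k + c * cfz f (k - 1).
Proof.
have [k0|] := ltP k 0; first by rewrite !cfz_lt0 ?mulr0 ?addr0 //; lia.
case: k => [[|m]|m] // _.
  by rewrite (@cfz_lt0 _ (0%:Z - 1)) // mulr0 addr0 /= mulrBr mulr1 cfB
    [f * _]mulrC -scalerAl cfZ [X * _]mulrC cfMX mulr0 subr0.
rewrite (_ : m.+1%:Z - 1 = m); last lia.
by rewrite /= mulrBr mulr1 cfB [f * (c *: X)]mulrC -scalerAl cfZ [X * _]mulrC cfMX subrK.
Qed.

Lemma cfz1 k : cfz 1 k = (k == 0)%:R.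
Proof. by case: k => [m|m] //=; rewrite cf1. Qed.

Let unitAz e : A ^ e * A = A ^ (e + 1).
Proof. by rewrite exprzDr ?mpser_geom_unit. Qed.

Lemma cfz_exp_pred k : cfz (A ^ (k - 1)) k = cfz 1 k.
Proof.
have [k0|] := ltP k 0; first by rewrite !cfz_lt0.
case: k => [[|m]|m] // _.
  rewrite (cfzB a) unitAz (@cfz_lt0 _ (0%:Z - 1)) // mulr0 addr0.
  by rewrite (_ : _ + 1 = 0).
rewrite (_ : m.+1%:Z - 1 = m); last lia.
by rewrite cfz1 /= cf_exp_eq0.
Qed.

(** Lagrange inversion for u = x / (1 + a x): the exponent k + m - 1 is the one for which all powers
    of 1 + a x in the residue cancel. It glues the regions of weights [a + b] and [b] at time 0.
    Both sides satisfy F(m + 1, k) = F(m, k) + b F(m + 1, k - 1). *)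
Lemma cfz_mobius (m : nat) k :
  cfz (A ^ (k + m - 1) * Gam ^ (- m%:Z)) k = cfz (B ^ (- m%:Z)) k.
Proof.
elim: m k => [|m ihm] k.
  by rewrite oppr0 !expr0z mulr1 addr0 cfz_exp_pred.
have hB k' : cfz (B ^ (- m.+1%:Z)) k' =
    cfz (B ^ (- m%:Z)) k' + b * cfz (B ^ (- m.+1%:Z)) (k' - 1).
  rewrite {1}(cfzB b) -{2}[B]expr1z -exprzDr ?mpser_geom_unit //.
  by rewrite (_ : - m.+1%:Z + 1 = - m%:Z) //; lia.
have hA k' : cfz (A ^ (k' + m.+1 - 1) * Gam ^ (- m.+1%:Z)) k' =
    cfz (A ^ (k' + m - 1) * Gam ^ (- m%:Z)) k' +
    b * cfz (A ^ (k' - 1 + m.+1 - 1) * Gam ^ (- m.+1%:Z)) (k' - 1).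
  (* The two series to compare are [U * A] and [U * Gam]; their coefficients differ by b times the
     previous coefficient of [U]. *)
  pose U := A ^ (k' + m - 1) * Gam ^ (- m.+1%:Z).
  have e1 : A ^ (k' + m.+1 - 1) * Gam ^ (- m.+1%:Z) = U * A.
    by rewrite /U mulrAC unitAz; congr (A ^ _ * _); lia.
  have e2 : A ^ (k' + m - 1) * Gam ^ (- m%:Z) = U * Gam.
    rewrite /U -mulrA -{3}[Gam]expr1z -exprzDr ?mpser_geom_unit //.
    by congr (_ * Gam ^ _); lia.
  rewrite e1 e2 (_ : k' - 1 + m.+1 - 1 = k' + m - 1); last lia.
  rewrite -/U; have := cfzB a U k'; have := cfzB (a + b) U k'.
  by move=> -> /(canRL (addrK _)) ->; ring.
have [k0|] := ltP k 0; first by rewrite !cfz_lt0.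
case: k => // k _; elim: k => [|k ihk].
  by rewrite hA hB ihm !(@cfz_lt0 _ (0%:Z - 1)).
rewrite hA hB ihm; congr (_ + b * _).
by rewrite (_ : k.+1%:Z - 1 = k); last lia.
Qed.

Definition lattice_weight t x : R :=
  if x < 0 then (if 0 <= t - x then a else a + b) else (if 0 <= t then b else a + b).

(* [t] is the sum of the two coordinates, after the shear that turns the diagonal
   steps into horizontal ones; the four cases correspond to the regions where the
   weights [a], [a + b] and [b] occur, and to the one beyond the targets. *)
Definition path_coef t x z : R :=
  cfz (if x <= t then (if t < 0 then A ^ (t - x + z - 1) else 1)
       else if t <= 0 then A ^ (z - 1) * Gam ^ (t - x) else B ^ (t - x)) (z - x).

(** This and the next two lemmas extend each formula to the closed region. A step from one region
    into another then uses the formula of the first at both ends. *)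
Lemma path_coef_a t x z : x <= t -> t <= 0 ->
  path_coef t x z = cfz (A ^ (t - x + z - 1)) (z - x).
Proof.
move=> xt t0; rewrite /path_coef xt; case: ltP => // h.
have -> : t = 0 by lia.
by rewrite -cfz_exp_pred; congr (cfz (A ^ _) _); lia.
Qed.

Lemma path_coef_ab t x z : t <= x -> t <= 0 ->
  path_coef t x z = cfz (A ^ (z - 1) * Gam ^ (t - x)) (z - x).
Proof.
move=> tx t0; have [<-|ne] := eqVneq t x.
  by rewrite path_coef_a // subrr expr0z mulr1 add0r.
by rewrite /path_coef t0 ifF //; lia.
Qed.

Lemma path_coef_b t x z : t <= x -> 0 <= t ->
  path_coef t x z = cfz (B ^ (t - x)) (z - x).
Proof.
move=> tx t0; have [<-|ne] := eqVneq t x.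
  by rewrite /path_coef lexx ltNge t0 /= subrr expr0z.
have [t1|t1] := eqVneq t 0; last first.
  by rewrite /path_coef !ifF //; apply/negbTE; rewrite -ltNge; lia.
rewrite t1 in tx ne *; rewrite path_coef_ab // !sub0r.
case: x => [m|m] in tx ne *; last by lia.
by rewrite -cfz_mobius; congr (cfz (A ^ _ * _) _); lia.
Qed.

(** In each closed region this is [cfzB] for the weight of that region, [c] being [a], [a + b] or
    [b]. *)
Lemma path_coef_rec t x z : t < Num.max 0 x ->
  path_coef t x z = path_coef (t + 1) x z + lattice_weight t x * path_coef (t + 1) (x + 1) z.
Proof.
move=> h; have ez : z - (x + 1) = z - x - 1 by lia.
have [xt|tx] := leP x t.
  have t0 : t < 0 by lia.
  rewrite !path_coef_a ?ez; try lia.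
  rewrite (cfzB a (A ^ (t - x + z - 1))) unitAz /lattice_weight ifT; last lia.
  rewrite ifT; last lia.
  by congr (cfz (A ^ _) _ + a * cfz (A ^ _) _); lia.
have [t0|t0] := ltP t 0.
  rewrite !path_coef_ab ?ez; try lia.
  rewrite (cfzB (a + b) (A ^ (z - 1) * Gam ^ (t - x))) -mulrA -{2}[Gam]expr1z.
  rewrite -exprzDr ?mpser_geom_unit //.
  have -> : lattice_weight t x = a + b.
    by rewrite /lattice_weight; case: ifP => _; rewrite ifF //; apply/negbTE;
      rewrite -ltNge; lia.
  congr (cfz (_ * Gam ^ _) _ + (a + b) * cfz (_ * Gam ^ _) _); lia.
rewrite !path_coef_b ?ez; try lia.
rewrite (cfzB b (B ^ (t - x))) -{2}[B]expr1z -exprzDr ?mpser_geom_unit //.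
rewrite /lattice_weight ifF ?t0; last by apply/negbTE; rewrite -leNgt; lia.
by congr (cfz (B ^ _) _ + b * cfz (B ^ _) _); lia.
Qed.

Lemma path_coef_frozen t x z : Num.max 0 x <= t -> path_coef t x z = (x == z)%:R.
Proof.
move=> h; rewrite /path_coef ifT; last lia.
rewrite ifF ?cfz1; last by apply/negbTE; rewrite -leNgt; lia.
by congr (_%:R); apply/eqP/eqP; lia.
Qed.

Variables (mu nu : intpart).
Local Notation n := (size mu).
Local Notation M := (part mu 0).

Definition start_pos (i : 'I_n) : int := i.+1%:Z - (part mu i)%:Z.
Definition end_pos (j : 'I_n) : int := j.+1%:Z - (part nu j)%:Z.

(* A walker waits at its source before its starting time, and the targets cannot
   be left. *)
Definition walker_weight t x : R :=
  if (t < Num.max 0 x) && [forall i : 'I_n, (x == start_pos i) ==> (- i%:Z <= t - x)]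
  then lattice_weight t x else 0.

Lemma start_pos_mono (i j : 'I_n) : (i < j)%N -> start_pos i < start_pos j.
Proof. by move=> h; have := part_le mu (ltnW h); rewrite /start_pos; lia. Qed.

Lemma end_pos_mono (i j : 'I_n) : (i < j)%N -> end_pos i < end_pos j.
Proof. by move=> h; have := part_le nu (ltnW h); rewrite /end_pos; lia. Qed.

Lemma start_pos_le (i j : 'I_n) : (start_pos i <= start_pos j) -> (i <= j)%N.
Proof. by rewrite leqNgt; move=> h; apply/negP => /start_pos_mono; rewrite ltNge h. Qed.

(** A walker that has left source [i] can only stand in the column of a source [k] with k at least
    i, whose waiting condition is weaker. The cut made for one walker therefore never hinders
    another. *)
Lemma walker_weightE t x (i : 'I_n) : start_pos i <= x -> - i%:Z <= t - x ->
  walker_weight t x = if t < Num.max 0 x then lattice_weight t x else 0.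
Proof.
move=> h1 h2; rewrite /walker_weight (_ : [forall i, _] = true) ?andbT //.
apply/forallP => k; apply/implyP => /eqP e; move: h1; rewrite e => /start_pos_le; lia.
Qed.

(** Induction on the remaining time up to [n]. A walker still to the right of time [n] at the end is
    also to the right of [z], which accounts for the bound on [z]. *)
Lemma walk_sum_path_coef r t x z (i : 'I_n) : t + r%:Z = n%:Z ->
  start_pos i <= x -> - i%:Z <= t - x -> z <= n%:Z ->
  walk_sum walker_weight r t x z = path_coef t x z.
Proof.
move=> + + + hz; elim: r t x => [|r ih] t x ht h1 h2.
  rewrite walk_sum0; have [xn|nx] := leP x t.
    by rewrite path_coef_frozen //; lia.
  rewrite /path_coef cfz_lt0; last lia.
  by case: eqP => // e; lia.
rewrite walk_sumS big_bool /= addr0 mul1r (walker_weightE h1 h2).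
rewrite !ih; try lia.
case: ifP => h; first by rewrite [RHS]path_coef_rec // [RHS]addrC.
by rewrite mul0r add0r !path_coef_frozen //; lia.
Qed.

Lemma walk_sum_wait d r t (i : 'I_n) z : t + d%:Z <= 1 - (part mu i)%:Z ->
  walk_sum walker_weight (d + r) t (start_pos i) z =
  walk_sum walker_weight r (t + d%:Z) (start_pos i) z.
Proof.
elim: d t => [|d ih] t ht; first by rewrite addr0.
rewrite addSn walk_sumS big_bool /= addr0 mul1r.
rewrite (_ : walker_weight _ _ = 0) ?mul0r ?add0r; last first.
  rewrite /walker_weight ifF //; apply/negP => /andP [_ /forallP /(_ i)].
  by rewrite eqxx /= /start_pos; lia.
by rewrite ih; [congr (walk_sum _ _ _ _ _); lia|lia].
Qed.

(** When walker [i] is released, t - x = -i and z - 1 = j - nu_j: the exponents of [Gam] and [A] in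
    [path_coef] are those of [jt_entry]. *)
Lemma walk_sum_jt_entry (i j : 'I_n) :
  walk_sum walker_weight (M + n) (- M%:Z) (start_pos i) (end_pos j) =
  jt_entry a b mu nu i j.
Proof.
have hp : (0 < part mu i)%N by rewrite intpart_gt0.
have hM := part_le mu (leq0n i); have hi := ltn_ord i; have hj := ltn_ord j.
have -> : (M + n = (M + 1 - part mu i) + (n + part mu i - 1))%N by lia.
rewrite walk_sum_wait; last lia.
rewrite (walk_sum_path_coef (i := i)) ?path_coef_ab /start_pos /end_pos; try lia.
rewrite /jt_entry.
have -> : Gam ^ (- M%:Z + (M + 1 - part mu i)%N%:Z - (i.+1%:Z - (part mu i)%:Z)) =
    (Gam ^+ i)^-1.
  by rewrite -[Gam ^+ i]/(Gam ^ i%:Z) invr_expz; congr (_ ^ _); lia.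
have -> : j.+1%:Z - (part nu j)%:Z - 1 = j%:Z - (part nu j)%:Z by lia.
case: leqP => h; last by rewrite cfz_lt0 //; lia.
have -> // : j.+1%:Z - (part nu j)%:Z - (i.+1%:Z - (part mu i)%:Z) =
  (part mu i + j - (part nu j + i))%N%:Z by lia.
Qed.

End ClosedForm.

Lemma count_iota_initial (P : pred nat) N :
  (forall i j, (i <= j)%N -> P j -> P i) -> (forall i, P i -> (i < N)%N) ->
  forall i, (i < count P (iota 0 N))%N = P i.
Proof.
move=> hd; elim: N => [|N ih] hN i; first by rewrite ltn0; apply/esym/negP => /hN.
rewrite -[N.+1]addn1 iotaD count_cat /= add0n addn0.
case hP: (P N) => /=; last first.
  rewrite addn0 ih // => j hj; have := hN j hj; rewrite ltnS leq_eqVlt => /predU1P [e|//].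
  by rewrite -e hj in hP.
rewrite addn1 (eq_in_count (a2 := predT)) => [|j]; last first.
  by rewrite mem_iota /= add0n => /ltnW hj; rewrite (hd _ N).
rewrite count_predT size_iota; apply/idP/idP => [hi|/hN //].
by apply: (hd i N).
Qed.

Lemma ltn_durfee (l : intpart) i : (i < durfee l)%N = (i < part l i)%N.
Proof.
rewrite /durfee; apply: (count_iota_initial (P := fun i => i < part l i)%N) =>
  [j k hjk hk|j hj].
  exact: leq_ltn_trans hjk (leq_trans hk (part_le l hjk)).
by rewrite -intpart_gt0 (leq_ltn_trans _ hj).
Qed.

(** * Lattice paths as walkers *)

Section SkewCoordinates.
Implicit Types (t x : int) (s : seq bool).
Local Notation ntrue := (count id).

(* With this shear, the time [t] increases by one at each step. *)
Definition point_at t x : lpoint := (x, t - Num.min x 0).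

Lemma point_at_inj t x t' x' : point_at t x = point_at t' x' -> t = t' /\ x = x'.
Proof. by case=> -> /addIr ->. Qed.

Fixpoint walk_points t x s : seq lpoint :=
  if s is c :: s' then
    point_at (t + 1) (x + c%:Z) :: walk_points (t + 1) (x + c%:Z) s' else [::].

Lemma walk_points_inj t x s s' : walk_points t x s = walk_points t x s' -> s = s'.
Proof.
elim: s s' t x => [|c s ih] [|c' s'] t x //= [/addrI ec _].
have -> : c = c' by case: c c' ec => [] [].
by move/ih ->.
Qed.

Lemma lattice_stepE t x q :
  lattice_step (point_at t x) q = [exists c : bool, q == point_at (t + 1) (x + c%:Z)].
Proof.
rewrite /lattice_step /up_step /right_step /diag_step /point_at /=.
apply/idP/existsP => [/or3P [/eqP ->|/andP [h /eqP ->]|/andP [h /eqP ->]]|[c /eqP ->]].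
- by exists false; rewrite addr0; apply/eqP; congr pair; lia.
- by exists true; apply/eqP; congr pair; lia.
- by exists true; apply/eqP; congr pair; lia.
case: c; last by apply/or3P/Or31/eqP; rewrite addr0; congr pair; lia.
have [h|h] := ltP x 0.
  by apply/or3P/Or32; rewrite /=; apply/eqP; congr pair; lia.
by apply/or3P/Or33; rewrite /=; apply/eqP; congr pair; lia.
Qed.

Lemma walk_points_path t x s : path lattice_step (point_at t x) (walk_points t x s).
Proof.
elim: s t x => //= c s ih t x; rewrite ih andbT lattice_stepE.
by apply/existsP; exists c.
Qed.

Lemma path_walk_points t x p : path lattice_step (point_at t x) p ->
  exists s, p = walk_points t x s.
Proof.
elim: p t x => [|q p ih] t x /=; first by exists [::].
rewrite lattice_stepE => /andP [/existsP [c /eqP ->]] /ih [s ->].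
by exists (c :: s).
Qed.

Lemma last_walk_points t x s :
  last (point_at t x) (walk_points t x s) = point_at (t + (size s)%:Z) (x + (ntrue s)%:Z).
Proof.
elim: s t x => [|c s ih] t x /=; first by rewrite !addr0.
by rewrite ih; congr point_at; lia.
Qed.

Lemma mem_walk_points t x s q : reflect
  (exists2 k, (k <= size s)%N & q = point_at (t + k%:Z) (walk_pos x s k))
  (q \in point_at t x :: walk_points t x s).
Proof.
apply: (iffP idP) => [|[k hk ->]].
  elim: s t x => [|c s ih] t x /=.
    by rewrite inE => /eqP ->; exists 0%N; rewrite // /walk_pos !addr0.
  rewrite inE => /predU1P [->|/ih [k hk ->]].
    by exists 0%N; rewrite // /walk_pos !addr0.
  by exists k.+1 => //; rewrite /walk_pos /=; congr point_at; lia.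
elim: k s t x hk => [|k ih] s t x hk.
  by rewrite /walk_pos take0 !addr0 mem_head.
case: s hk => // c s hk /=; rewrite in_cons.
have -> : point_at (t + k.+1%:Z) (walk_pos x (c :: s) k.+1) =
    point_at (t + 1 + k%:Z) (walk_pos (x + c%:Z) s k).
  by rewrite /walk_pos /=; congr point_at; lia.
by rewrite ih ?orbT.
Qed.

Variables (R : idomainType) (a b : R).

Lemma step_weightE t x (c : bool) :
  step_weight a b (point_at t x) (point_at (t + 1) (x + c%:Z)) =
  if c then lattice_weight a b t x else 1.
Proof.
rewrite /step_weight /right_step /diag_step /point_at /lattice_weight /=.
case: c; last first.
  have e : (x + 0 == x + 1) = false by lia.
  by rewrite !xpair_eqE e !andbF.
have [h|h] := ltP x 0.
  by rewrite (_ : _ == _ = true) //; apply/eqP; congr pair; lia.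
by rewrite /= subr0 (_ : _ == _ = true) //; apply/eqP; congr pair; lia.
Qed.

Lemma lpath_weightE t x s :
  lpath_weight a b (point_at t x) (walk_points t x s) =
  walk_weight (lattice_weight a b) t x s.
Proof.
rewrite /lpath_weight; elim: s t x => [|c s ih] t x /=; first by rewrite big_nil.
by rewrite big_cons step_weightE ih.
Qed.

Lemma walk_weight_cat w t x s s' : walk_weight (R := R) w t x (s ++ s') =
  walk_weight w t x s * walk_weight w (t + (size s)%:Z) (x + (ntrue s)%:Z) s'.
Proof.
elim: s t x => [|c s ih] t x /=; first by rewrite !addr0 mul1r.
rewrite ih mulrA; congr (_ * walk_weight _ _ _ _); lia.
Qed.

Lemma walk_weight_nseq w t x d : walk_weight (R := R) w t x (nseq d false) = 1.
Proof. by elim: d t x => //= d ih t x; rewrite ih mul1r. Qed.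

Lemma ntrue_nseq d : ntrue (nseq d false) = 0%N.
Proof. by elim: d. Qed.

Lemma ntrue_take s k k' : (k <= k')%N ->
  (ntrue (take k s) <= ntrue (take k' s) <= ntrue (take k s) + (k' - k))%N.
Proof.
move=> h; have -> : take k' s = take k s ++ take (k' - k) (drop k s).
  by rewrite -{1}(subnKC h) takeD.
rewrite count_cat leq_addr leq_add2l /=.
by rewrite (leq_trans (count_size _ _)) // size_take_min geq_minl.
Qed.

End SkewCoordinates.

Lemma ntrue_take_nseq k d : count id (take k (nseq d false)) = 0%N.
Proof. by elim: d k => [|d ih] [|k] //=; rewrite ih. Qed.

(** * Families of lattice paths as walkers with a common clock *)

Section PathFamilies.
Variables (R : idomainType) (a b : R) (mu nu : intpart).
Local Notation ntrue := (count id).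
Local Notation n := (size mu).
Local Notation M := (part mu 0).
Local Notation T := (M + n)%N.
Local Notation start := (@start_pos mu).
Local Notation stop := (@end_pos mu nu).
Local Notation ww := (walker_weight a b mu).
Implicit Types (i j : 'I_n).

Definition start_time i : int := 1 - (part mu i)%:Z.
(** The clock runs from -M to n, early and late enough for all paths. The truncated subtraction in
    [duration] encodes the time max(0, i - nu_i) of the target. *)
Definition delay i : nat := (M + 1 - part mu i)%N.
Definition duration i : nat := (i - part nu i + part mu i - 1)%N.

Lemma part_size_gt0 i : (0 < part mu i)%N. Proof. by rewrite intpart_gt0. Qed.

Lemma source_point i : source mu i = point_at (start_time i) (start i).
Proof.
rewrite /source ltn_durfee /point_at /start_time /start_pos.
by case: ifP => h; congr pair; lia.
Qed.

Lemma target_point i : target nu i = point_at (i - part nu i)%N (stop i).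
Proof.
rewrite /target ltn_durfee /point_at /end_pos.
by case: ifP => h; congr pair; lia.
Qed.

Lemma delay_duration i : (delay i + duration i <= T)%N.
Proof.
have := part_size_gt0 i; have := part_le mu (leq0n i); have := ltn_ord i.
by rewrite /delay /duration; lia.
Qed.

Lemma delayE i : - M%:Z + (delay i)%:Z = start_time i.
Proof. by have := part_le mu (leq0n i); rewrite /delay /start_time; lia. Qed.

Lemma durationE i : start_time i + (duration i)%:Z = (i - part nu i)%N.
Proof. by have := part_size_gt0 i; rewrite /duration /start_time; lia. Qed.

Definition pad i (s : seq bool) : seq bool :=
  nseq (delay i) false ++ s ++ nseq (T - delay i - duration i) false.

Definition unpad i (s : seq bool) : seq bool := take (duration i) (drop (delay i) s).

Lemma size_pad i s : size s = duration i -> size (pad i s) = T.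
Proof. by move=> h; rewrite !size_cat !size_nseq h; have := delay_duration i; lia. Qed.

Lemma padK i s : size s = duration i -> unpad i (pad i s) = s.
Proof. by move=> h; rewrite /unpad /pad drop_size_cat ?size_nseq // take_size_cat. Qed.

Lemma size_unpad i s : size s = T -> size (unpad i s) = duration i.
Proof.
move=> h; rewrite size_takel // size_drop h; have := delay_duration i; lia.
Qed.

Lemma ntrue_pad i s : ntrue (pad i s) = ntrue s.
Proof. by rewrite !count_cat !ntrue_nseq addn0. Qed.

(** Between source and target the cut weights agree with the lattice weights. *)
Lemma walk_weight_pad i s : size s = duration i -> start i + (ntrue s)%:Z = stop i ->
  walk_weight ww (- M%:Z) (start i) (pad i s) =
  walk_weight (lattice_weight a b) (start_time i) (start i) s.
Proof.
move=> hs he; rewrite /pad walk_weight_cat walk_weight_nseq mul1r walk_weight_cat.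
rewrite walk_weight_nseq mulr1 size_nseq delayE ntrue_nseq addr0.
(* Before a move some time is left, and the distance left is at most that time; this yields
   [t < Num.max 0 x], so the walker is not yet frozen. *)
have key u t x : - i%:Z <= t - x -> start i <= x -> x + (ntrue u)%:Z = stop i ->
    t + (size u)%:Z = (i - part nu i)%N ->
    walk_weight ww t x u = walk_weight (lattice_weight a b) t x u.
  elim: u t x => //= c u ih t x h1 h2 h3 h4.
  have hn : (ntrue u <= size u)%N := count_size _ _.
  rewrite ih; try by case: (c) h3 => /=; lia.
  congr (_ * _); case: c h3 => //= h3.
  rewrite (walker_weightE _ _ h2 h1) ifT //.
  by move: h3; rewrite /end_pos; lia.
by apply: key => //; rewrite ?hs ?durationE // /start_time /start_pos; lia.
Qed.

(** A move before the release meets the waiting condition, and a move after the arrival time starts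
    at x <= t with t >= 0; both have weight 0. *)
Lemma walk_weight_neq0_pad i s : size s = T -> start i + (ntrue s)%:Z = stop i ->
  walk_weight ww (- M%:Z) (start i) s != 0 -> pad i (unpad i s) = s.
Proof.
move=> hs he nz.
have hpre d t u : t + d%:Z <= start_time i -> (d <= size u)%N ->
    walk_weight ww t (start i) u != 0 -> take d u = nseq d false.
  elim: d t u => [|d ih] t [|c u] //= ht hd; case: c => /=.
    rewrite (_ : ww _ _ = 0) ?mul0r ?eqxx // /walker_weight ifF //.
    apply/negP => /andP [_ /forallP /(_ i)]; rewrite eqxx /=.
    by move: ht; rewrite /start_time /start_pos; lia.
  by rewrite mul1r addr0 => /ih -> //; lia.
have hpost u t x : (i - part nu i)%N%:Z <= t -> x + (ntrue u)%:Z = stop i ->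
    walk_weight ww t x u != 0 -> u = nseq (size u) false.
  elim: u t x => //= c u ih t x ht hx; case: c hx => /= hx.
    rewrite (_ : ww _ _ = 0) ?mul0r ?eqxx // /walker_weight ifF //.
    apply/negP => /andP [h _].
    by move: h hx ht; rewrite /end_pos; lia.
  rewrite mul1r addr0 => hw; congr (_ :: _); apply: (ih _ _ _ _ hw) => //; lia.
have hdd := delay_duration i.
have hd : take (delay i) s = nseq (delay i) false.
  by apply: (hpre _ (- M%:Z)) => //; [rewrite delayE | rewrite hs; lia].
have es : s = nseq (delay i) false ++ unpad i s ++ drop (duration i) (drop (delay i) s).
  by rewrite /unpad cat_take_drop -{1}hd cat_take_drop.
rewrite [RHS]es /pad; congr (_ ++ (_ ++ _)).
move: nz he; rewrite {1 2}es !walk_weight_cat !mulf_eq0 !negb_or =>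
  /andP [_ /andP [_ nz]].
rewrite !count_cat ntrue_nseq add0n => he.
have hsz := size_unpad i hs.
rewrite [RHS](hpost _ _ _ _ _ nz) ?size_drop ?hs //.
- by rewrite size_nseq hsz delayE durationE.
- by rewrite ntrue_nseq addr0 -he PoszD addrA.
Qed.

Definition padded (B : {ffun 'I_n -> T.-tuple bool}) : bool :=
  [forall i, pad i (unpad i (B i)) == B i] &&
    [forall i, start i + (ntrue (B i))%:Z == stop i].

Definition family_paths (B : {ffun 'I_n -> T.-tuple bool}) : {ffun 'I_n -> seq lpoint} :=
  [ffun i => walk_points (start_time i) (start i) (unpad i (B i))].

Section Family.
Variable B : {ffun 'I_n -> T.-tuple bool}.
Hypothesis padB : padded B.

Let pos i k := walk_pos (start i) (B i) k.

Lemma padded_eq i : B i = pad i (unpad i (B i)) :> seq bool.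
Proof. by have /andP [/forallP /(_ i) /eqP ->] := padB. Qed.

Lemma padded_stop i : start i + (ntrue (B i))%:Z = stop i.
Proof. by have /andP [_ /forallP /(_ i) /eqP] := padB. Qed.

Lemma padded_size i : size (unpad i (B i)) = duration i.
Proof. by rewrite size_unpad // size_tuple. Qed.

Lemma padded_ntrue i : start i + (ntrue (unpad i (B i)))%:Z = stop i.
Proof. by rewrite -padded_stop {2}padded_eq ntrue_pad. Qed.

Lemma pos_before i k : (k <= delay i)%N -> pos i k = start i.
Proof.
move=> h; rewrite /pos /walk_pos padded_eq /pad take_cat size_nseq.
case: ltnP => h'; first by rewrite take_nseq ?ntrue_nseq ?addr0 // ltnW.
by rewrite (_ : k - delay i = 0)%N ?take0 ?cats0 ?ntrue_nseq ?addr0 //; lia.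
Qed.

Lemma pos_during i k : (k <= duration i)%N ->
  pos i (delay i + k) = walk_pos (start i) (unpad i (B i)) k.
Proof.
move=> h; rewrite /pos /walk_pos {1}padded_eq /pad take_cat size_nseq.
rewrite ltnNge leq_addr /= addKn count_cat ntrue_nseq add0n take_cat padded_size.
case: ltnP => // h'; rewrite (_ : k - duration i = 0)%N; last lia.
by rewrite take0 cats0 take_oversize // padded_size.
Qed.

Lemma pos_after i k : (delay i + duration i <= k)%N -> pos i k = stop i.
Proof.
move=> h; rewrite -padded_ntrue /pos /walk_pos {1}padded_eq /pad take_cat size_nseq.
rewrite ltnNge (leq_trans (leq_addr _ _) h) /= count_cat ntrue_nseq add0n take_cat padded_size.
rewrite ltnNge (_ : duration i <= _)%N /=; last lia.
by rewrite count_cat ntrue_take_nseq addn0.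
Qed.

Lemma mem_family_paths i q : reflect
  (exists2 k, (delay i <= k <= delay i + duration i)%N & q = point_at (k%:Z - M%:Z) (pos i k))
  (q \in source mu i :: family_paths B i).
Proof.
rewrite ffunE source_point; apply: (iffP (mem_walk_points _ _ _ _)) => [] [k hk ->].
  exists (delay i + k)%N; first by rewrite -(padded_size i); lia.
  rewrite pos_during -?(padded_size i) //; congr point_at.
  by rewrite -delayE; lia.
exists (k - delay i)%N; first by rewrite padded_size; lia.
rewrite -pos_during ?subnKC; try lia.
by congr point_at; rewrite -delayE; lia.
Qed.

Lemma pos_le i k k' : (k <= k')%N -> pos i k <= pos i k' <= pos i k + (k' - k)%N%:Z.
Proof. by move=> h; have := ntrue_take (B i) h; rewrite /pos /walk_pos; lia. Qed.

Lemma family_paths_lpath i : is_lpath (source mu i) (target nu i) (family_paths B i).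
Proof.
rewrite /is_lpath ffunE source_point target_point walk_points_path last_walk_points.
by rewrite padded_size padded_ntrue durationE eqxx.
Qed.

(** A vertex determines its time, so two paths share a vertex exactly when the walkers meet while
    both are active. The point of the converse is that a first meeting cannot involve a waiting
    walker. *)
Lemma noncrossing_disjoint : noncrossing start B = disjoint_paths nu (family_paths B).
Proof.
have hp i := pos_before (i := i); have hq i := pos_after (i := i).
apply/forallP/andP => [h|[_ /forallP h] k].
  split; first by apply/forallP => i; apply: family_paths_lpath.
  have hlt i j q : (i < j)%N -> q \in source mu i :: family_paths B i ->
      q \in source mu j :: family_paths B j -> False.
    move=> hij /mem_family_paths [k hk ->] /mem_family_paths [k' hk' /point_at_inj [ek e]].
    have kk : k = k' by lia.
    have hT : (k < T.+1)%N.
      by rewrite ltnS; case/andP: hk => _ /leq_trans; apply; apply: delay_duration.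
    have /increasingP/(_ _ _ hij) := h (Ordinal hT).
    by rewrite /= -/(pos i k) -/(pos j k) e kk ltxx.
  apply/forallP => i; apply/forallP => j; apply/implyP => nij; apply/hasPn => q hq1.
  apply/negP => hq2; have [hij|hij|eij] := ltngtP i j.
  - exact: hlt hij hq2 hq1.
  - exact: hlt hij hq1 hq2.
  - by case/eqP: nij; apply: val_inj.
have disj i j k1 : (i < j)%N -> (delay i <= k1 <= delay i + duration i)%N ->
    (delay j <= k1 <= delay j + duration j)%N -> pos i k1 <> pos j k1.
  move=> hij hi hj e; have /forallP /(_ j) /implyP hh := h i.
  have nij : i != j by rewrite -val_eqE /= ltn_eqF.
  case/negP: (hh nij); apply/hasP.
  exists (point_at (k1%:Z - M%:Z) (pos i k1)); first by rewrite e;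
    apply/mem_family_paths; exists k1.
  by apply/mem_family_paths; exists k1.
apply/increasingP => i j hij; rewrite -/(pos i k) -/(pos j k).
have hs := start_pos_mono hij; have he := end_pos_mono nu hij.
elim: (k : nat) => [|m ih]; first by rewrite !hp.
have li := pos_le i (leqnSn m); have lj := pos_le j (leqnSn m).
rewrite lt_neqAle andbC; apply/andP; split; first lia.
apply/eqP => e.
have si := pos_le i (leq0n m.+1); have sj := pos_le j (leq0n m.+1).
rewrite hp // in si; rewrite hp // in sj.
(* If [i] is still waiting, it stands strictly left of the source of [j]. *)
have [h1|h1] := leqP (delay i) m.+1; last by rewrite hp ?(ltnW h1) // in e; lia.
have ui := pos_le i h1; rewrite hp // in ui.
(* If [j] is still waiting, [i] is too slow: it has been active for less than mu_i - mu_j steps, and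
   the distance between the sources is larger. *)
have [h2|h2] := leqP (delay j) m.+1; last first.
  rewrite [in RHS]hp ?(ltnW h2) // in e.
  have := part_le mu (leq0n i); have := part_le mu (leq0n j).
  by move: ui e h1 h2; move: (pos i _) => u; rewrite /start_pos /delay; lia.
(* If [j] has arrived, it stands at its target, strictly right of all positions of [i]. *)
have [h4|h4] := leqP m.+1 (delay j + duration j); last first.
  rewrite [in RHS]hq ?(ltnW h4) // in e.
  have := pos_le i (leq_maxl m.+1 (delay i + duration i)).
  by rewrite (hq i (maxn _ _)) ?leq_maxr //; lia.
have vj := pos_le j h4; rewrite (hq j _ (leqnn _)) in vj.
(* If [i] has arrived, [j] has less time left than the difference of the two arrival times, which is
   at most the distance of the targets; so [j] is already beyond the target of [i]. *)
have [h3|h3] := leqP m.+1 (delay i + duration i); last first.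
  rewrite [in LHS]hq ?(ltnW h3) // in e.
  have := part_le mu (leq0n i); have := part_le mu (leq0n j).
  have := part_size_gt0 i; have := part_size_gt0 j.
  by move: vj e he h2 h3 h4; move: (pos j _) => u; rewrite /end_pos /delay /duration; lia.
by apply: disj hij _ _ e; rewrite ?h1 ?h2.
Qed.

End Family.

(** Padding is a bijection from the disjoint path families onto the noncrossing padded walkers; it
    preserves weights, and all other noncrossing walkers with the right ends have weight 0. *)
Lemma fcoef_jt_det : fcoef a b mu nu = jt_det a b n mu nu.
Proof.
have -> : jt_det a b n mu nu = \sum_(B :
  {ffun 'I_n -> T.-tuple bool} | noncrossing start B &&
    padded B) \prod_i walk_weight ww (- M%:Z) (start i) (B i).
  rewrite /jt_det; under eq_mx do rewrite -walk_sum_jt_entry.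
  rewrite det_walk_sum; first last.
  - by apply/increasingP => i j hij; apply: (end_pos_mono nu hij).
  - by apply/increasingP => i j hij; apply: start_pos_mono hij.
  rewrite big_mkcond [RHS]big_mkcond; apply: eq_bigr => B _; rewrite /padded.
  case: (noncrossing _ _) => //=;
    have [he|_] := boolP [forall i, start i + (ntrue (B i))%:Z == stop i];
    last by rewrite andbF.
  rewrite andbT; case: forallP => // np; apply/eqP/contraT => nz; case: np => i;
    apply/eqP.
  apply: walk_weight_neq0_pad; first by rewrite size_tuple.
    by apply/eqP; apply: (forallP he).
  by move/prodf_neq0: nz; apply.
pose good := [pred B : {ffun 'I_n -> T.-tuple bool} | noncrossing start B && padded B].
(* The sum ranges over an infinite type of families of vertex lists; the images of the good walkers
   exhaust its support. *)
rewrite /fcoef (fsbigE (map family_paths (enum good))).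
- rewrite big_map big_enum_cond /=; apply: eq_big => [B|B /andP [/andP [_ hB] _]].
    rewrite inE; apply: andb_idr => /andP [h1 h2]; apply/mem_set.
    by rewrite /= -noncrossing_disjoint.
  apply: eq_bigr => i _; rewrite ffunE source_point lpath_weightE.
  rewrite -(walk_weight_pad (padded_size B i) (padded_ntrue hB i)).
  by congr walk_weight; rewrite -(padded_eq hB i).
- rewrite map_inj_in_uniq ?enum_uniq // => B B'; rewrite !mem_enum =>
  /andP [_ hB] /andP [_ hB'] e.
  apply/ffunP => i; apply: val_inj; rewrite /= (padded_eq hB) (padded_eq hB').
  by have := congr1 (fun P : {ffun 'I_n -> seq lpoint} => P i) e; rewrite !ffunE =>
    /walk_points_inj ->.
- move=> P /= /mapP [B]; rewrite mem_enum => /andP [h1 h2] ->.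
  by rewrite -noncrossing_disjoint.
move=> P /= hP /negP []; have /andP [/forallP h1 _] := hP.
have hs i : exists s, [/\ P i = walk_points (start_time i) (start i) s, size s = duration i &
    start i + (ntrue s)%:Z = stop i].
  have := h1 i; rewrite /is_lpath source_point target_point =>
    /andP [/path_walk_points [s ->]].
  rewrite last_walk_points => /eqP /point_at_inj [e1 e2]; exists s; split=> //.
  by have := durationE i; lia.
have [s hs'] := choice hs.
have hsz i : size (pad i (s i)) == T by have [_ h _] := hs' i; rewrite size_pad.
pose B : {ffun 'I_n -> T.-tuple bool} := [ffun i => Tuple (hsz i)].
have hB : padded B.
  apply/andP; split; apply/forallP => i; rewrite ffunE /=; have [_ h2 h3] := hs' i.
    by rewrite padK.
  by rewrite ntrue_pad h3.
have eP : P = family_paths B.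
  by apply/ffunP => i; rewrite !ffunE /=; have [-> h2 _] := hs' i; rewrite padK.
apply/mapP; exists B => //; rewrite mem_enum inE hB andbT.
by rewrite noncrossing_disjoint -?eP.
Qed.

End PathFamilies.

(** * The two expansions *)

Section Expansion.
Variables (R : idomainType) (a b : R).
Implicit Types (l m mu nu : intpart).
Local Notation gcoord nu l := (scoord l (groth (- a) (- b) nu)).

(** The new last row is 0 except for a final entry 1, the constant term of a quotient of series with
    constant term 1. The path count has order [size mu], while a box needs one order for all its
    partitions. *)
Lemma jt_detS n mu nu : (size mu <= n)%N -> (size nu <= n)%N ->
  jt_det a b n.+1 mu nu = jt_det a b n mu nu.
Proof.
move=> hmu hnu; rewrite /jt_det (expand_det_row _ ord_max) (bigD1 ord_max) //=.
rewrite [Z in _ + Z]big1 ?addr0 => [|j nj]; last first.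
  rewrite !mxE /jt_entry [part mu _]part_default // ifF ?mul0r //.
  by move: nj (ltn_ord j); rewrite -val_eqE /=; lia.
rewrite !mxE /jt_entry /= !part_default // subnn leqnn subr0 cf0M.
rewrite (_ : _ ^ n%:Z = (1 - a *: mpser_var ord0) ^+ n) // cf0X.
have hc c : cf (1 - c *: mpser_var ord0 : mpser 1 R) 0 = 1.
  by rewrite cfB cf1 cfZ cfX mulr0 subr0.
have hV c : cf (((1 - c *: mpser_var ord0 : mpser 1 R) ^+ n)^-1) 0 = 1.
  have u : (1 - c *: mpser_var ord0 : mpser 1 R) ^+ n \is a GRing.unit.
    by rewrite unitrX // mpser_geom_unit.
  by have := congr1 (fun f => cf f 0%N) (divrr u);
    rewrite /= cf0M cf1 cf0X hc expr1n mul1r.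
rewrite hc hV expr1n !mul1r /cofactor -signr_odd oddD addbb expr0 mul1r.
congr (\det _); apply/matrixP => i j; rewrite !mxE.
by congr jt_entry; apply: lift_max.
Qed.

Lemma fcoefE n mu nu : (size nu <= size mu)%N -> (size mu <= n)%N ->
  fcoef a b mu nu = jt_det a b n mu nu.
Proof.
move=> h1 /subnK <-; elim: (n - size mu)%N => [|d ih]; first exact: fcoef_jt_det.
by rewrite addSn jt_detS ?leq_addl // (leq_trans h1) // leq_addl.
Qed.

Lemma in_box_le n M l m : subpart l m -> in_box n M m -> in_box n M l.
Proof.
move=> h /andP [h1 h2]; rewrite /in_box (leq_trans (subpart_size h) h1).
by move/subpartP: h => /(_ 0%N) /leq_trans; apply.
Qed.

Lemma in_box_sumn n l : (sumn l <= n)%N -> in_box n n l.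
Proof.
by move=> h; rewrite /in_box !(leq_trans _ h) ?size_le_sumn ?part_le_sumn.
Qed.

Lemma sum_subset (s s' : seq intpart) (T : pred intpart) (F : intpart -> R) :
  uniq s -> uniq s' -> (forall l, T l -> l \in s) -> (forall l, T l -> l \in s') ->
  (forall l, ~~ T l -> F l = 0) -> \sum_(l <- s) F l = \sum_(l <- s') F l.
Proof.
move=> us us' hs hs' hF.
have h r : \sum_(l <- r) F l = \sum_(l <- r | T l) F l.
  by rewrite [RHS]big_mkcond; apply: eq_bigr => l _; case: ifP => // /negbT /hF.
rewrite (h s) (h s') -big_filter -[RHS]big_filter; apply: perm_big.
apply: uniq_perm; rewrite ?filter_uniq // => l; rewrite !mem_filter.
by case hT: (T l) => //=; rewrite hs ?hs'.
Qed.

(** The coordinate at [l] only involves the [nu] between [mu] and [l], so it can be computed in a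
    box containing [mu] and [l]. *)
Lemma schur_groth_expansion mu :
  sums_to (fun nu : intpart => subpart mu nu)
    (fun nu : intpart => fcoef a b nu mu *: groth (- a) (- b) nu)
    (schur mu : symfun R).
Proof.
apply: sums_toP => l s us hs; rewrite scoord_schur.
pose n := maxn (sumn mu) (sumn l).
have bmu : in_box n n mu by rewrite in_box_sumn ?leq_maxl.
have bl : in_box n n l by rewrite in_box_sumn ?leq_maxr.
have /andP [hln _] := bl; rewrite -(gcoord_jt_det a b bmu bl) big_mkcond.
pose T := [pred nu | subpart mu nu && subpart nu l].
rewrite (@sum_subset s (box n n) T) ?box_uniq //.
- rewrite big_seq [RHS]big_seq; apply: eq_bigr => nu; rewrite mem_box => /andP [hn _].
  case: ifP => [h|/negbT h]; last by rewrite jt_det_eq0 ?mul0r // (andP bmu).1.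
  by rewrite linearZ /= (fcoefE (subpart_size h) hn).
- by move=> nu /andP [_ /subpart_sumn]; apply: hs.
- by move=> nu /andP [_ h]; rewrite mem_box (in_box_le h).
move=> nu; rewrite /T /= negb_and; case: ifP => //= _ h.
by rewrite linearZ /= gcoord_eq0 ?mulr0.
Qed.

Definition dual_property mu (g : symfun R) : Prop :=
  forall m : intpart, hall g (groth (- a) (- b) m) = (mu == m)%:R.

Definition dual_sum mu : symfun R :=
  \sum_(nu \in [set nu : intpart | subpart nu mu]%classic)
    fcoef a b mu nu *: (schur nu : symfun R).

Lemma scoord_dual_sum mu l : scoord l (dual_sum mu) =
  if subpart l mu then fcoef a b mu l else 0.
Proof.
pose r := [seq nu <- undup (intparts_lt (sumn mu).+1) | subpart nu mu].
have ur : uniq r by rewrite filter_uniq ?undup_uniq.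
have hr nu : (nu \in r) = subpart nu mu.
  rewrite mem_filter andb_idr // => h; rewrite mem_undup mem_intparts_lt //.
  by rewrite ltnS subpart_sumn.
have e : [set nu : intpart | subpart nu mu]%classic = [set` r]%classic.
  by apply/seteqP; split=> nu /=; rewrite hr.
rewrite /dual_sum e -fsbig_seq //.
rewrite (big_morph (fun g : symfun R => scoord l g) (id1 := 0) (op1 := +%R)); first last.
- exact: (raddf0 (scoord l)).
- by move=> g h; apply: (raddfD (scoord l)).
have hZ (c : R) (f : symfun R) : scoord l (symfun_val (c *: f)) = c * scoord l f.
  by rewrite -[symfun_val (c *: f)]/(c *: symfun_val f) linearZ.
under eq_bigr do rewrite hZ scoord_schur.
rewrite -hr; case: ifP => [hl|/negbT hl].
  rewrite (bigD1_seq l) //= eqxx mulr1 big1 ?addr0 // => nu nl.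
  by rewrite (negbTE nl) mulr0.
rewrite big_seq big1 // => nu hnu; case: eqP => [el|_]; last by rewrite mulr0.
by rewrite -el hnu in hl.
Qed.

Lemma dual_sum_dual mu : dual_property mu (dual_sum mu).
Proof.
move=> m; pose n := maxn (sumn mu) (sumn m).
have bmu : in_box n n mu by rewrite in_box_sumn ?leq_maxl.
have bm : in_box n n m by rewrite in_box_sumn ?leq_maxr.
have hd l : ((sumn mu).+1 <= sumn l)%N -> scoord l (dual_sum mu) = 0.
  by rewrite scoord_dual_sum; case: ifP => // /subpart_sumn; rewrite leqNgt => /negbTE ->.
rewrite (hallE _ hd (undup_uniq (intparts_lt (sumn mu).+1))); last first.
  by move=> l hl; rewrite mem_undup mem_intparts_lt.
rewrite -(jt_det_gcoord a b bmu bm).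
rewrite (@sum_subset _ (box n n) (subpart^~ mu)) ?undup_uniq ?box_uniq //.
- rewrite big_seq [RHS]big_seq; apply: eq_bigr => l; rewrite mem_box => /andP [hn _].
  rewrite scoord_dual_sum; case: ifP => [h|/negbT h]; last by rewrite jt_det_eq0.
  by rewrite (fcoefE (subpart_size h) (andP bmu).1).
- by move=> l h; rewrite mem_undup mem_intparts_lt // ltnS subpart_sumn.
- by move=> l h; rewrite mem_box (in_box_le h).
by move=> l /negbTE h; rewrite scoord_dual_sum h mul0r.
Qed.

(** Uniqueness of the dual element: writing each delta as a combination of the coordinates of the G
    and exchanging sums gives the coordinate of [g] as a combination of the pairings of [g] with the
    G, all but one of which vanish. Large [n] makes the box contain the support of [g]. *)
Lemma dual_property_coord mu g nu : dual_property mu g ->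
  exists N, forall n, (N <= n)%N -> scoord nu g = jt_det a b n mu nu.
Proof.
move=> hg; have [d hd] := scoord_bounded g.
exists (maxn d (maxn (sumn mu) (sumn nu))) => n; rewrite !geq_max => /and3P [dn mn nn].
have bmu := in_box_sumn mn; have bnu := in_box_sumn nn.
have hdb l : (sumn l < d)%N -> l \in box n n.
  by move=> hl; rewrite mem_box in_box_sumn // (leq_trans (ltnW hl)).
transitivity (\sum_(l <- box n n) scoord l g * (nu == l)%:R).
  rewrite (bigD1_seq nu) ?mem_box ?box_uniq //= eqxx mulr1 big1 ?addr0 // => l nl.
  by rewrite eq_sym (negbTE nl) mulr0.
transitivity (\sum_(l <- box n n) \sum_(m <- box n n)
    jt_det a b n m nu * (scoord l g * gcoord m l)).
  rewrite big_seq [RHS]big_seq; apply: eq_bigr => l; rewrite mem_box => bl.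
  rewrite -(gcoord_jt_det a b bnu bl) mulr_sumr; apply: eq_bigr => m _.
  by rewrite mulrCA.
rewrite exchange_big /= (bigD1_seq mu) ?mem_box ?box_uniq //=.
rewrite -mulr_sumr -(hallE _ hd (box_uniq n n) hdb) hg eqxx mulr1.
rewrite big1 ?addr0 // => m nm.
by rewrite -mulr_sumr -(hallE _ hd (box_uniq n n) hdb) hg eq_sym (negbTE nm) mulr0.
Qed.

Lemma dual_groth_expansion mu : dual_groth a b mu = dual_sum mu.
Proof.
have h1 := @dual_sum_dual mu.
have h2 : dual_property mu (dual_groth a b mu).
  rewrite /dual_groth; apply: (@xgetPex _ _ [set g :
    symfun R | dual_property mu g]%classic).
  by exists (dual_sum mu).
apply/val_inj/symserP => nu.
have [N1 e1] := dual_property_coord nu h1; have [N2 e2] := dual_property_coord nu h2.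
by rewrite (e1 (maxn N1 N2)) ?leq_maxl // (e2 (maxn N1 N2)) ?leq_maxr.
Qed.

End Expansion.

Theorem theorem9p8 (mu : intpart) :
  sums_to (fun nu : intpart => subpart mu nu)
    (fun nu : intpart =>
       fcoef alpha beta nu mu *: groth (- alpha) (- beta) nu)
    (schur mu : symfun Zab)
  /\
  dual_groth alpha beta mu =
    \sum_(nu \in [set nu : intpart | subpart nu mu]%classic)
      fcoef alpha beta mu nu *: (schur nu : symfun Zab).
Proof. by split; [apply: schur_groth_expansion|apply: dual_groth_expansion]. Qed.
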